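(* Let $S_n$ be the Birkhoff sums of the Saint-Petersburg potential under the doubling map, and for a function $\Psi$ of $n$ and $\beta\in[0,\infty]$ let $E_\Psi(\beta)=\{x\in(0,1]:\lim_{n\to\infty}S_n(x)/\Psi(n)=\beta\}$. (1) If $\Psi(n)=n\log n$, or $\Psi(n)=n^a$ for some $a>1$, or $\Psi(n)=2^{n^\gamma}$ for some $0<\gamma<1/2$, then $\dim_H E_\Psi(\beta)=1$ for every $\beta\in[0,\infty]$. (2) If $\Psi(n)=2^{n^\gamma}$ with $1/2\le\gamma<1$, then $E_\Psi(\beta)$ is empty for every $\beta\in(0,\infty)$, and $\dim_H E_\Psi(\beta)=1$ for $\beta=0$ and for $\beta=+\infty$. (3) If $\Psi(n)=2^{n^\gamma}$ with $\gamma\ge1$, then $E_\Psi(\beta)$ is empty for every $\beta\in(0,\infty]$, and $\dim_H E_\Psi(0)=1$.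
   Context: $T:(0,1]\to(0,1]$ is the doubling map $Tx=2x-\lceil 2x\rceil+1$, where $\lceil y\rceil$ is the smallest integer $\ge y$. The Saint-Petersburg potential $\varphi:(0,1]\to\mathbb{R}$ is defined by $\varphi(x)=2^n$ if $x\in(2^{-n-1},2^{-n}]$, for each integer $n\ge0$. For $n\ge1$, $S_n(x)=\varphi(x)+\varphi(Tx)+\cdots+\varphi(T^{n-1}x)$. For $\beta=+\infty$ the limit defining $E_\Psi(\beta)$ means divergence to $+\infty$. $\dim_H$ denotes Hausdorff dimension. *)

(* Defs.v *)
From mathcomp Require Import all_boot all_order all_algebra.
From mathcomp Require Import all_classical all_reals all_analysis.
Import Order.TTheory GRing.Theory Num.Theory.
Import numFieldNormedType.Exports.

Set Implicit Arguments.
Unset Strict Implicit.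
Unset Printing Implicit Defensive.

Local Open Scope classical_set_scope.
Local Open Scope ring_scope.

Section Hausdorff.
Context {R : realType}.
Implicit Types (A U : set R) (s delta : R).

(* [diam set0] is -oo; [gauge] treats the empty set separately. *)
Definition diam U : \bar R :=
  ereal_sup [set (`|x - y|)%:E | x in U & y in U].

(* Since 0 `^ 0 = 1, H^0 is the counting measure; the empty set always
   contributes 0. *)
Definition gauge s U : \bar R :=
  if U == set0 then 0%E else (diam U `^ s)%E.

Definition delta_cover delta A (U : nat -> set R) : Prop :=
  A `<=` \bigcup_i U i /\ forall i, (diam (U i) <= delta%:E)%E.

Definition hausdorff_premeasure s delta A : \bar R :=
  ereal_inf [set (\sum_(0 <= i <oo) gauge s (U i))%E | U in delta_cover delta A].

(* The premeasure is nonincreasing in [delta], so this supremum is its limit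
   as [delta] tends to 0 from the right. *)
Definition hausdorff_measure s A : \bar R :=
  ereal_sup [set hausdorff_premeasure s delta A | delta in [set d | 0 < d]].

Definition hausdorff_dim A : \bar R :=
  ereal_inf [set s%:E | s in [set s | 0 <= s /\ hausdorff_measure s A = 0%E]].

End Hausdorff.

Section SaintPetersburg.
Context {R : realType}.
Implicit Types (x : R) (n : nat) (beta : \bar R).

Definition doubling x : R := 2 * x - (Num.ceil (2 * x))%:~R + 1.

(* For x in ]0, 1] there is exactly one such n (see [saint_petersburgE]);
   outside ]0, 1] the value is irrelevant. *)
Definition saint_petersburg x : R :=
  2 ^+ xget 0%N [set n : nat | 2 ^- n.+1 < x <= 2 ^- n].

Lemma saint_petersburgE n x :
  2 ^- n.+1 < x <= 2 ^- n -> saint_petersburg x = 2 ^+ n.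
Proof.
move=> /andP[nx xn]; congr (_ ^+ _); apply: xget_unique => /=.
  by rewrite nx xn.
have aux (i j : nat) : 2 ^- i.+1 < x -> x <= 2 ^- j -> (j <= i)%N.
  move=> ix xj; have := lt_le_trans ix xj.
  by rewrite ltf_pV2 ?posrE ?exprn_gt0// ltr_eXn2l ?ltr1n// ltnS.
by move=> m /andP[mx xm]; apply/eqP; rewrite eqn_leq !aux.
Qed.

Definition birkhoff_sum n x : R :=
  \sum_(0 <= k < n) saint_petersburg (iter k doubling x).

(* Convergence in \bar R: for [beta = +oo] this is divergence to +oo. *)
Definition level_set (Psi : nat -> R) beta : set R :=
  [set x | 0 < x <= 1 /\
           (birkhoff_sum n x / Psi n)%:E @[n --> \oo] --> beta].

End SaintPetersburg.

(* Main.v *)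
(** Read a point of ]0, 1] as a binary sequence with infinitely many ones: a run
    of zeros closed by a one, of total length [m], contributes [2 ^ m - 1] to the
    Birkhoff sum.

    Dimension one.  Prescribe the digits on a set of positions of density at most
    [1 - s] and leave the others free.  Reading off the free digits is Hoelder of
    exponent [s] and maps onto ]0, 1], so the resulting set has positive
    [s]-dimensional Hausdorff measure.  The prescribed digits are ones at the
    multiples of [M], which make all uncontrolled terms at most [2 ^ M] and thus
    their sum negligible against Psi, and sparse blocks (one run each) that
    produce the growth.  For a finite level [r] the [k]-th block starts at
    [k ^ 2] and is chosen greedily so that the sum stays below [r * Psi (k ^ 2)];
    the deficit is halved at every step up to the increment of Psi, so it is
    negligible because Psi (k.+1 ^ 2) / Psi (k ^ 2) tends to 1.  For the level
    +oo the blocks start at [2 ^ k].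

    Emptiness.  If gamma < 1 and the level is positive and finite, no single term
    is comparable to Psi(n), but some terms exceed Psi(n) / n.+1 ^ 2, hence start a run
    of length about [n ^ gamma >= sqrt n], along which the sum is almost constant
    while Psi gains a factor bounded away from 1.  If gamma >= 1, the ratio
    S_n / Psi(n) is at most 1 and drops by a factor of about 2 at the end of
    every run. *)
Require Import Defs.
From mathcomp Require Import all_boot all_order all_algebra.
From mathcomp Require Import all_classical all_reals all_analysis.
From mathcomp Require Import ring lra zify.
Import Order.TTheory GRing.Theory Num.Theory.
Import numFieldNormedType.Exports.

Set Implicit Arguments.
Unset Strict Implicit.
Unset Printing Implicit Defensive.

Local Open Scope classical_set_scope.
Local Open Scope ring_scope.

(** * Binary digits *)

Section Dyadic.
Context {R : realType}.
Implicit Types (x y t : R) (e : nat -> bool).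

Lemma dyadic_scale x : 0 < x <= 1 -> exists n : nat, 2 ^- n.+1 < x <= 2 ^- n.
Proof.
move=> /andP[x0 x1].
have hP : exists n : nat, 2 ^- n.+1 < x.
  exists (Num.truncn x^-1).
  rewrite invf_plt ?posrE ?exprn_gt0//.
  have : x^-1 < (Num.truncn x^-1).+1%:R by apply: truncnS_gt.
  move=> /lt_trans; apply.
  by rewrite -natrX ltr_nat ltn_expl.
have [n hn hmin] := ex_minnP hP.
exists n; rewrite hn /=; case: n hn hmin => [|n] _ hmin; first by rewrite invr1.
by rewrite leNgt; apply/negP => /hmin; rewrite ltnn.
Qed.

Lemma doubling_low x : 0 < x <= 1 / 2 -> doubling x = 2 * x.
Proof.
move=> /andP[x0 x1]; rewrite /doubling.
suff -> : Num.ceil (2 * x) = 1 by rewrite subrK.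
by apply/eqP; rewrite ceil_eq; apply/andP; split; lra.
Qed.

Lemma doubling_high x : 1 / 2 < x <= 1 -> doubling x = 2 * x - 1.
Proof.
move=> /andP[x0 x1]; rewrite /doubling.
suff -> : Num.ceil (2 * x) = 2 by rewrite intrD; lra.
by apply/eqP; rewrite ceil_eq; apply/andP; split; lra.
Qed.

Lemma doubling_itv x : 0 < x <= 1 -> 0 < doubling x <= 1.
Proof.
move=> /andP[x0 x1]; have [h|h] := leP x (1 / 2).
  by rewrite doubling_low ?x0//; lra.
by rewrite doubling_high ?h//; lra.
Qed.

Lemma iter_doubling_itv n x : 0 < x <= 1 -> 0 < iter n doubling x <= 1.
Proof. by move=> x01; elim: n => //= n; apply: doubling_itv. Qed.

Lemma saint_petersburg_high x : 1 / 2 < x <= 1 -> saint_petersburg x = 1.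
Proof.
by move=> h; rewrite (@saint_petersburgE _ 0) ?expr0// expr1 invr1 -div1r.
Qed.

Lemma saint_petersburg_low x :
  0 < x <= 1 / 2 -> saint_petersburg x = 2 * saint_petersburg (doubling x).
Proof.
move=> /andP[x0 x12]; have [|[|n] /andP[nx xn]] := @dyadic_scale x.
- by rewrite x0 /=; lra.
- by move: nx; rewrite expr1; lra.
rewrite (@saint_petersburgE _ n.+1) ?nx ?xn// exprS; congr (_ * _).
rewrite doubling_low ?x0//.
rewrite (@saint_petersburgE _ n)//; move: nx xn.
rewrite !exprS !invfM; set u := (2 ^+ n)^-1 => nx xn; lra.
Qed.

Lemma saint_petersburg_ge1 x : 1 <= saint_petersburg x.
Proof. by apply: exprn_ege1; rewrite ler1n. Qed.

(** Read backwards along an orbit, this bounds all earlier terms by the current one. *)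
Lemma saint_petersburg_double x :
  0 < x <= 1 -> saint_petersburg x <= 2 * saint_petersburg (doubling x).
Proof.
move=> /andP[x0 x1]; have [h|h] := leP x (1 / 2).
  by rewrite -saint_petersburg_low ?x0.
rewrite saint_petersburg_high ?h//; have := saint_petersburg_ge1 (doubling x).
lra.
Qed.

(** A value above 1 forces the point into the left half, where one doubling step halves the
    potential. *)
Lemma saint_petersburg_run x n i : saint_petersburg x = 2 ^+ n -> 0 < x <= 1 ->
  (i <= n)%N -> saint_petersburg (iter i doubling x) = 2 ^+ (n - i).
Proof.
move=> xn x01; elim: i => [|i IH] i_n; first by rewrite subn0.
have {}IH := IH (ltnW i_n).
have /andP[y0 y1] := iter_doubling_itv i x01.
rewrite iterS; set y := iter i doubling x in IH y0 y1 *.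
have [h|h] := leP y (1 / 2).
  have := @saint_petersburg_low y; rewrite y0 h => /(_ isT).
  rewrite IH; have -> : 2 ^+ (n - i) = 2 * 2 ^+ (n - i.+1) :> R.
    by rewrite -exprS -subSn.
  lra.
have : saint_petersburg y = 1 by rewrite saint_petersburg_high ?h.
rewrite IH; case: (n - i)%N (subn_gt0 i n) => [|k _]; first by rewrite i_n.
rewrite exprS; have : 1 <= 2 ^+ k :> R by apply: exprn_ege1; rewrite ler1n.
lra.
Qed.

Lemma birkhoff_sumS n x : birkhoff_sum n.+1 x =
  birkhoff_sum n x + saint_petersburg (iter n doubling x).
Proof. by rewrite /birkhoff_sum big_nat_recr. Qed.

Lemma birkhoff_sum_ge n x : n%:R <= birkhoff_sum n x.
Proof.
elim: n => [|n IH]; first by rewrite /birkhoff_sum big_geq.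
by rewrite birkhoff_sumS -natr1 lerD// saint_petersburg_ge1.
Qed.

Lemma birkhoff_sum_mono x : {homo (birkhoff_sum ^~ x) : m n / (m <= n)%N >-> m <= n}.
Proof.
apply: homo_leq => [//|y z w|n]; first exact: le_trans.
by rewrite birkhoff_sumS lerDl (le_trans _ (saint_petersburg_ge1 _)).
Qed.

(* The binary digits of the expansion with infinitely many ones. *)
Definition bdigit t k : bool := 1 / 2 < iter k doubling t.

Definition dyadic_sum e n : R := \sum_(0 <= k < n) (e k)%:R * 2 ^- k.+1.

Lemma dyadic_sumSl e n :
  dyadic_sum e n.+1 = ((e 0%N)%:R + dyadic_sum (fun k => e k.+1) n) / 2.
Proof.
rewrite /dyadic_sum big_nat_recl// mulrDl expr1; congr (_ + _).
rewrite mulr_suml; apply: eq_bigr => i _.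
by rewrite [in LHS]exprSr invfM mulrA.
Qed.

Lemma dyadic_sum_bdigit t n : 0 < t <= 1 ->
  t = dyadic_sum (bdigit t) n + 2 ^- n * iter n doubling t.
Proof.
move=> t01; elim: n => [|n IH].
  by rewrite /dyadic_sum big_geq// add0r invr1 mul1r.
rewrite {1}IH /dyadic_sum big_nat_recr//= -addrA; congr (_ + _).
have := iter_doubling_itv n t01.
rewrite /bdigit; set y := iter n doubling t => /andP[y0 y1].
rewrite exprS invfM; have [h|h] := leP y (1 / 2).
  by rewrite doubling_low ?y0// mul0r add0r; lra.
by rewrite doubling_high ?h// mul1r; lra.
Qed.

(** The partial sums coincide, and the remainders are points of ]0, 1] scaled by [2 ^- n]. *)
Lemma bdigit_close t t' n : 0 < t <= 1 -> 0 < t' <= 1 ->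
  (forall k, (k < n)%N -> bdigit t k = bdigit t' k) -> `|t - t'| <= 2 ^- n.
Proof.
move=> t01 t01' htt'.
rewrite (dyadic_sum_bdigit n t01) (dyadic_sum_bdigit n t01').
have -> : dyadic_sum (bdigit t) n = dyadic_sum (bdigit t') n.
  rewrite /dyadic_sum !big_nat; apply: eq_bigr => k /andP[_ kn].
  by rewrite htt'.
rewrite opprD addrACA subrr add0r -mulrBr normrM.
rewrite ger0_norm ?invr_ge0 ?exprn_ge0//.
rewrite ler_piMr ?invr_ge0 ?exprn_ge0//.
have /andP[? ?] := iter_doubling_itv n t01.
have /andP[? ?] := iter_doubling_itv n t01'.
by rewrite ler_norml; apply/andP; split; lra.
Qed.

Lemma dyadic_sum_itv e n : 0 <= dyadic_sum e n <= 1.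
Proof.
elim: n e => [|n IH] e; first by rewrite /dyadic_sum big_geq// lexx ler01.
rewrite dyadic_sumSl; have /andP[] := IH (fun k => e k.+1).
by case: (e 0%N) => /=; lra.
Qed.

Definition dyadic_val e : R := limn (dyadic_sum e).

Lemma cvg_dyadic_sum e : dyadic_sum e n @[n --> \oo] --> dyadic_val e.
Proof.
apply: nondecreasing_is_cvgn.
  apply/nondecreasing_seqP => n; rewrite /dyadic_sum big_nat_recr//= lerDl.
  by rewrite mulr_ge0// invr_ge0 exprn_ge0.
exists 1 => _ [n _ <-]; by have /andP[] := dyadic_sum_itv e n.
Qed.

Lemma dyadic_valS e :
  dyadic_val e = ((e 0%N)%:R + dyadic_val (fun k => e k.+1)) / 2.
Proof.
apply/cvg_lim => //; rewrite -cvg_shiftS.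
rewrite (_ : (fun n => _) = (fun n =>
    ((e 0%N)%:R + dyadic_sum (fun k => e k.+1) n) / 2)); last first.
  by apply/funext => n; exact: dyadic_sumSl.
apply: cvgMl; apply: cvgD; first exact: cvg_cst.
exact: cvg_dyadic_sum.
Qed.

Lemma dyadic_val_itv e : 0 <= dyadic_val e <= 1.
Proof.
apply/andP; split.
  apply: limr_ge; first by apply/cvg_ex; exists (dyadic_val e); exact: cvg_dyadic_sum.
  by near=> n; have /andP[] := dyadic_sum_itv e n.
apply: limr_le; first by apply/cvg_ex; exists (dyadic_val e); exact: cvg_dyadic_sum.
by near=> n; have /andP[] := dyadic_sum_itv e n.
Unshelve. all: by end_near. Qed.

Lemma dyadic_val_ge e k : e k -> 2 ^- k.+1 <= dyadic_val e.
Proof.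
elim: k e => [|k IH] e ek; rewrite dyadic_valS.
  by rewrite ek expr1 /=; have := dyadic_val_itv (fun k => e k.+1); lra.
rewrite exprS invfM; have := IH (fun k => e k.+1) ek.
by case: (e 0%N) => /=; lra.
Qed.

Lemma dyadic_val_le e k : ~~ e k -> dyadic_val e <= 1 - 2 ^- k.+1.
Proof.
elim: k e => [|k IH] e ek; rewrite dyadic_valS.
  by rewrite (negbTE ek) expr1 /=; have := dyadic_val_itv (fun k => e k.+1); lra.
rewrite exprS invfM; have := IH (fun k => e k.+1) ek.
by case: (e 0%N) => /=; lra.
Qed.

(* A common digit soon after the first difference excludes neighbours such as
   0.1000... and 0.0111..., whose distance is not controlled by the position of
   that difference. *)
Lemma dyadic_val_sep_head e e' i M : e 0%N != e' 0%N -> (0 < i <= M)%N ->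
  e i = e' i -> 2 ^- M.+1 <= `|dyadic_val e - dyadic_val e'|.
Proof.
wlog : e e' / e 0%N.
  move=> h ee' iM eei; case e0: (e 0%N); first by apply: (h _ _ _ _ iM).
  rewrite distrC; apply: (h e' e _ _ iM); last by [].
    by move: ee'; rewrite e0; case: (e' 0%N).
  by rewrite eq_sym.
move=> e0; rewrite e0; case e'0: (e' 0%N) => // _ /andP[].
case: i => // i _ iM eei.
rewrite (dyadic_valS e) (dyadic_valS e') e0 e'0 /=.
apply: le_trans (ler_norm _).
have h : (2 : R) ^- M <= 2 ^- i.+1.
  by rewrite lef_pV2 ?posrE ?exprn_gt0// ler_weXn2l ?ler1n.
rewrite exprS invfM.
have := dyadic_val_itv (fun k => e k.+1); have := dyadic_val_itv (fun k => e' k.+1).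
(* The values lie on either side of 1/2. A common one keeps the larger value away from 1/2, a common
   zero the smaller one. *)
case ei: (e i.+1).
  have := @dyadic_val_ge (fun k => e k.+1) i ei; lra.
have := @dyadic_val_le (fun k => e' k.+1) i; rewrite -eei ei => /(_ isT); lra.
Qed.

(** Each common leading digit halves the distance, which reduces the claim to a difference at
    position 0. *)
Lemma dyadic_val_sep e e' n i M : (forall k, (k < n)%N -> e k = e' k) ->
  e n != e' n -> (0 < i <= M)%N -> e (n + i)%N = e' (n + i)%N ->
  2 ^- (n + M).+1 <= `|dyadic_val e - dyadic_val e'|.
Proof.
elim: n e e' => [|n IH] e e' eq_e ne_e iM eei.
  exact: (@dyadic_val_sep_head e e' i M).
rewrite (dyadic_valS e) (dyadic_valS e') eq_e// -mulrBl opprD addrACA subrr add0r normrM.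
rewrite addSn exprSr invfM.
rewrite [X in _ <= _ * X]ger0_norm ?invr_ge0// ler_pM2r ?invr_gt0//.
by apply: IH => // k kn; apply: eq_e.
Qed.

Definition infinitely_one e := forall n, exists2 k, (n <= k)%N & e k.

Lemma dyadic_val_gt0 e : infinitely_one e -> 0 < dyadic_val e.
Proof.
move=> /(_ 0%N)[k _ ek]; apply: lt_le_trans (@dyadic_val_ge e k ek).
by rewrite invr_gt0 exprn_gt0.
Qed.

Lemma infinitely_oneS e : infinitely_one e -> infinitely_one (fun k => e k.+1).
Proof. by move=> h n; have [[//|k] nk ek] := h n.+1; exists k. Qed.

(** Infinitely many ones make the tail positive, so a leading one puts the value strictly above 1/2,
    on the right branch of the map. *)
Lemma doubling_dyadic_val e : infinitely_one e ->
  doubling (dyadic_val e) = dyadic_val (fun k => e k.+1).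
Proof.
move=> /infinitely_oneS h; have := dyadic_valS e.
have := dyadic_val_itv (fun k => e k.+1); have := dyadic_val_gt0 h.
case: (e 0%N) => /= h0 /andP[_ h1] hv.
  by rewrite doubling_high ?hv//; lra.
by rewrite doubling_low ?hv//; lra.
Qed.

Lemma infinitely_one_shift e n :
  infinitely_one e -> infinitely_one (fun k => e (n + k)%N).
Proof.
move=> h m; have [k mk ek] := h (n + m)%N; exists (k - n)%N; first lia.
by rewrite subnKC//; lia.
Qed.

Lemma iter_doubling_dyadic_val e n : infinitely_one e ->
  iter n doubling (dyadic_val e) = dyadic_val (fun k => e (n + k)%N).
Proof.
move=> h; elim: n => [//|n IH]; rewrite iterS IH doubling_dyadic_val.
  by congr dyadic_val; apply/funext => k; rewrite addnS.
exact: infinitely_one_shift.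
Qed.

Lemma saint_petersburg_dyadic_val e r : infinitely_one e -> e r ->
  (forall k, (k < r)%N -> ~~ e k) -> saint_petersburg (dyadic_val e) = 2 ^+ r.
Proof.
elim: r e => [|r IH] e h er e0.
  rewrite saint_petersburg_high// dyadic_valS er /=.
  have := dyadic_val_gt0 (infinitely_oneS h).
  by have := dyadic_val_itv (fun k => e k.+1); lra.
have v0 := dyadic_val_gt0 h.
have := dyadic_val_itv (fun k => e k.+1).
rewrite saint_petersburg_low; last first.
  rewrite v0 dyadic_valS (negbTE (e0 0%N _))//=.
  by have := dyadic_val_itv (fun k => e k.+1); lra.
move=> _; rewrite doubling_dyadic_val// (IH (fun k => e k.+1)) ?exprS//.
  exact: infinitely_oneS.
by move=> k kr; apply: e0.
Qed.

End Dyadic.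

(** * Hausdorff dimension *)

Section HausdorffDimension.
Context {R : realType}.
Implicit Types (A B U : set R) (s d : R).

Lemma gauge_ge0 s U : (0 <= gauge s U)%E.
Proof. by rewrite /gauge; case: ifP => // _; apply: poweR_ge0. Qed.

Lemma dist_le_diam U x y : U x -> U y -> (`|x - y|%:E <= diam U)%E.
Proof. by move=> Ux Uy; apply: ereal_sup_ubound; exists x => //; exists y. Qed.

Lemma diam_fin U x d : U x -> (diam U <= d%:E)%E ->
  exists2 r, 0 <= r <= d & diam U = r%:E.
Proof.
move=> Ux Ud; have := dist_le_diam Ux Ux; rewrite subrr normr0.
case: (diam U) Ud => [r| |]//; rewrite !lee_fin => rd r0.
by exists r; rewrite // r0.
Qed.

Lemma gauge_le s U d : 0 <= s -> 0 <= d -> (diam U <= d%:E)%E ->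
  (gauge s U <= (d `^ s)%:E)%E.
Proof.
move=> s0 d0 Ud; rewrite /gauge; case: ifPn => [_|/set0P[x Ux]].
  by rewrite lee_fin powR_ge0.
have [r /andP[r0 rd] ->] := diam_fin Ux Ud.
by rewrite poweR_EFin lee_fin ge0_ler_powR// nnegrE.
Qed.

Lemma hausdorff_premeasure_ge0 s d A : (0 <= hausdorff_premeasure s d A)%E.
Proof.
apply/ereal_infP => _ [U _ <-].
by apply: nneseries_ge0 => i _ _; apply: gauge_ge0.
Qed.

(** About [n] intervals of length [1 / n] cover ]0, 1], and their total gauge is of order
    [n ^ (1 - s)], which tends to 0. *)
Lemma hausdorff_premeasure_gt1 s d A :
  A `<=` [set x | 0 < x <= 1] -> 1 < s -> 0 < d ->
  hausdorff_premeasure s d A = 0%E.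
Proof.
move=> A01 s1 d0; apply/eqP; rewrite eq_le hausdorff_premeasure_ge0 andbT.
apply/lee_addgt0Pr => e e0; rewrite add0e.
(* With [n.+1 > c] the total gauge is at most [e]; adding [d^-1] brings the mesh below [d]. *)
pose c := (2 / e) `^ (s - 1)^-1.
pose n := Num.truncn (c + d^-1).
have hn : c + d^-1 < n.+1%:R by apply: truncnS_gt.
have c0 : 0 <= c by apply: powR_ge0.
have di0 : 0 < d^-1 by rewrite invr_gt0.
(* Indices run up to [n.+1] because [x = 1] truncates to [n.+1]. *)
pose U i := if (i < n.+2)%N then `[i%:R / n.+1%:R, i.+1%:R / n.+1%:R]%classic
  else set0 : set R.
have Ud i : (diam (U i) <= (n.+1%:R^-1)%:E)%E.
  apply/ereal_supP => _ [x Ux [y Uy <-]]; rewrite lee_fin.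
  move: Ux Uy; rewrite /U; case: ifP => //= _; rewrite !in_itv/=.
  rewrite -(natr1 i) mulrDl mul1r; set v := n.+1%:R^-1; set w := i%:R * v.
  by move=> /andP[? ?] /andP[? ?]; rewrite ler_norml; apply/andP; split; lra.
have nd : n.+1%:R^-1 <= d.
  by rewrite invf_ple ?posrE//; apply: ltW; lra.
have cov : delta_cover d A U.
  split=> [x /A01 /andP[x0 x1]|i]; last by rewrite (le_trans (Ud i))// lee_fin.
  have x0' : 0 <= x * n.+1%:R by rewrite mulr_ge0// ltW.
  have /andP[h1 h2] := truncn_itv x0'.
  exists (Num.truncn (x * n.+1%:R)) => //=.
  rewrite /U; case: ifPn => [_|]/=.
    by rewrite in_itv/= ler_pdivrMr// h1/= ler_pdivlMr// ltW.
  rewrite -leqNgt -(ler_nat R) => h3.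
  have : x * n.+1%:R <= n.+1%:R by rewrite ler_piMl.
  have : n.+1%:R < n.+2%:R :> R by rewrite ltr_nat.
  by move: (le_trans h3 h1); lra.
apply: le_trans (_ : (\sum_(0 <= i <oo) gauge s (U i) <= _)%E).
  by apply: ereal_inf_lbound; exists U.
rewrite (@nneseries_split _ _ 0 n.+2) ?add0n; last by move=> *; apply: gauge_ge0.
rewrite [X in (_ + X)%E]eseries0 ?adde0; last first.
  by move=> i ni _; rewrite /gauge /U ltnNge ni/= eqxx.
apply: le_trans (_ : (\sum_(0 <= i < n.+2) ((n.+1%:R^-1) `^ s)%:E <= _)%E).
  by apply: lee_sum => i _; apply: gauge_le => //; lra.
rewrite sumEFin lee_fin sumr_const_nat subn0.
have n0 : 0 < n.+1%:R :> R by [].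
have -> : (n.+1%:R^-1) `^ s = n.+1%:R^-1 / n.+1%:R `^ (s - 1) :> R.
  rewrite -mulr_powRB1 ?invr_ge0//; last by lra.
  congr (_ * _).
  by rewrite -powR_inv1// -powRrM mulN1r powRN.
have h : 2 / e <= n.+1%:R `^ (s - 1).
  have -> : 2 / e = c `^ (s - 1).
    rewrite /c -powRrM mulVf ?powRr1 ?divr_ge0// ?ltW//.
    by apply/eqP; lra.
  by rewrite ge0_ler_powR ?nnegrE//; lra.
have p0 : 0 < n.+1%:R `^ (s - 1) :> R by apply: powR_gt0.
rewrite -[_ *+ n.+2]mulr_natl mulrA ler_pdivrMr//.
apply: le_trans (_ : 2 <= _).
  by rewrite ler_pdivrMr// -natrM ler_nat; lia.
by rewrite mulrC -ler_pdivrMr.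
Qed.

Lemma hausdorff_dim_le1 A : A `<=` [set x | 0 < x <= 1] ->
  (hausdorff_dim A <= 1)%E.
Proof.
move=> A01; apply/lee_addgt0Pr => e e0; apply: ereal_inf_lbound.
exists (1 + e); last by rewrite EFinD.
split=> /=; first lra.
apply/eqP; rewrite eq_le; apply/andP; split.
  apply/ereal_supP => _ [d d0 <-].
  by rewrite hausdorff_premeasure_gt1//; lra.
by rewrite -(hausdorff_premeasure_gt1 A01 (_ : 1 < 1 + e) ltr01) ?ltrDl//;
  apply: ereal_sup_ubound; exists 1 => /=.
Qed.

(** All points of the preimage of [U] lie within [K * r ^ s] of any one of them, where [r] is the
    diameter; [J] is the interval of that radius. *)
Lemma cover_pullback s K sigma U : 0 <= s -> 0 <= K -> (diam U < +oo)%E ->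
  (forall t t', 0 < t <= 1 -> 0 < t' <= 1 ->
    `|t - t'| <= K * `|sigma t - sigma t'| `^ s) ->
  exists J : set R, [/\ measurable J,
    (lebesgue_measure J <= (2 * K)%:E * gauge s U)%E &
    forall t, 0 < t <= 1 -> U (sigma t) -> J t].
Proof.
move=> s0 K0 Uoo hol.
have [[t0 [t001 Ut0]]|no] :=
  pselect (exists t0, 0 < t0 <= 1 /\ U (sigma t0)); last first.
  exists set0; split => //.
    by rewrite measure0 mule_ge0 ?gauge_ge0// lee_fin mulr_ge0.
  by move=> t t01 Ut; apply: no; exists t.
have [d Ud] : exists d, (diam U <= d%:E)%E.
  move: (dist_le_diam Ut0 Ut0) Uoo; rewrite subrr normr0.
  by case: (diam U) => [r _ _|//|//]; exists r.
have {Ud} [r /andP[r0 _] Ur] := diam_fin Ut0 Ud.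
have -> : gauge s U = (r `^ s)%:E.
  by rewrite /gauge Ur; case: ifPn => // /eqP U0; rewrite U0 in Ut0.
have rs0 := powR_ge0 r s.
exists `[t0 - K * r `^ s, t0 + K * r `^ s]%classic; split => //.
  rewrite lebesgue_measure_itv/= lte_fin; case: ifP => _.
    by rewrite -EFinB -EFinM lee_fin; lra.
  by rewrite -EFinM lee_fin mulr_ge0// mulr_ge0.
move=> t t01 Ut; rewrite /= in_itv/= -ler_distlC.
apply: le_trans (hol _ _ t001 t01) _; apply: ler_wpM2l => //.
apply: ge0_ler_powR; rewrite ?nnegrE//.
by rewrite -lee_fin -Ur; apply: dist_le_diam.
Qed.

(** A cover of [A] pulls back to a cover of ]0, 1] by intervals, whose Lebesgue measures add up to
    at least 1; hence the gauges add up to at least [(2 * K)^-1]. *)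
Lemma hausdorff_measure_gt0 s K sigma A : 0 <= s -> 0 < K ->
  (forall t, 0 < t <= 1 -> A (sigma t)) ->
  (forall t t', 0 < t <= 1 -> 0 < t' <= 1 ->
    `|t - t'| <= K * `|sigma t - sigma t'| `^ s) ->
  (0 < hausdorff_measure s A)%E.
Proof.
move=> s0 K0 sigmaA hol.
apply: (@lt_le_trans _ _ ((2 * K)^-1)%:E).
  by rewrite lte_fin invr_gt0 mulr_gt0.
apply: (@le_trans _ _ (hausdorff_premeasure s 1 A)); last first.
  by apply: ereal_sup_ubound; exists 1 => /=.
apply/ereal_infP => _ [U [covU dU] <-].
have hJ i : exists J : set R, [/\ measurable J,
    (lebesgue_measure J <= (2 * K)%:E * gauge s (U i))%E &
    forall t, 0 < t <= 1 -> U i (sigma t) -> J t].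
  by apply: cover_pullback => //; [exact: ltW|exact: le_lt_trans (ltry 1)].
have {hJ} [J hJ] := choice hJ.
have : (lebesgue_measure `]0%R, 1%R]%classic <=
        \sum_(0 <= i <oo) lebesgue_measure (J i) :> \bar R)%E.
  apply: measure_sigma_subadditive => //.
    by move=> i; have [] := hJ i.
  move=> t; rewrite /= in_itv/= => t01.
  have [i _ Ui] := covU _ (sigmaA t t01).
  by exists i => //; have [_ _] := hJ i; apply.
rewrite lebesgue_measure_itv/= lte_fin ltr01 -EFinB subr0 => h.
rewrite -(@lee_pmul2l _ (2 * K)%:E) ?lte_fin ?mulr_gt0//.
rewrite -EFinM mulfV ?gt_eqF ?mulr_gt0//.
apply: (le_trans h); rewrite -nneseriesZl; last by move=> i _; apply: gauge_ge0.
by apply: lee_nneseries => [//|i _]; have [] := hJ i.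
Qed.

Lemma hausdorff_premeasure_mono s d A B : A `<=` B ->
  (hausdorff_premeasure s d A <= hausdorff_premeasure s d B)%E.
Proof.
move=> AB; apply: ereal_inf_le_tmp => _ [U [BU dU] <-].
by exists U => //; split => //; exact: subset_trans BU.
Qed.

Lemma hausdorff_dim_mono A B : A `<=` B -> (hausdorff_dim A <= hausdorff_dim B)%E.
Proof.
move=> AB; apply: ereal_inf_le_tmp => _ [s [s0 Bs] <-]; exists s => //; split => //.
apply/eqP; rewrite eq_le; apply/andP; split.
  rewrite -Bs; apply/ereal_supP => _ [d d0 <-].
  apply: le_trans (hausdorff_premeasure_mono s d AB) _.
  by apply: ereal_sup_ubound; exists d.
apply: le_trans (hausdorff_premeasure_ge0 s 1 A) _.
by apply: ereal_sup_ubound; exists 1 => /=.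
Qed.

Lemma hausdorff_dim_ge A u : 0 <= u ->
  (forall s, 0 <= s < u -> (0 < hausdorff_measure s A)%E) ->
  (u%:E <= hausdorff_dim A)%E.
Proof.
move=> u0 hs; apply/ereal_infP => _ [s [s0 As] <-]; rewrite lee_fin leNgt.
by apply/negP => su; have := hs s; rewrite s0 su As ltxx => /(_ isT).
Qed.

End HausdorffDimension.

(** * Sets with prescribed digits *)

Section Prescribed.
Context {R : realType}.
Implicit Types (F b u : nat -> bool) (s C t : R).

Definition free_count F n : nat := \sum_(0 <= i < n) ~~ F i.

Definition fill F b u k : bool := if F k then b k else u (free_count F k).

Lemma free_countS F n : free_count F n.+1 = (free_count F n + ~~ F n)%N.
Proof. by rewrite /free_count big_nat_recr. Qed.

Lemma free_count_surj F n k : (k < free_count F n)%N ->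
  exists j, [/\ (j < n)%N, ~~ F j & free_count F j = k].
Proof.
elim: n => [|n IH]; first by rewrite /free_count big_geq.
rewrite free_countS; case Fn: (F n) => /=.
  by rewrite addn0 => /IH[j [jn Fj jk]]; exists j; rewrite ltnS ltnW.
rewrite addn1 ltnS leq_eqVlt => /orP[/eqP ->|].
  by exists n; rewrite ltnSn Fn.
by move=> /IH[j [jn Fj jk]]; exists j; rewrite ltnS ltnW.
Qed.

Lemma fill_inj F b u u' n :
  (forall k, (k < n)%N -> fill F b u k = fill F b u' k) ->
  forall k, (k < free_count F n)%N -> u k = u' k.
Proof.
move=> h k /free_count_surj[j [jn Fj <-]].
by have := h j jn; rewrite /fill (negbTE Fj).
Qed.

(** If the filled sequences first differ at [n], a common forced digit within [M] places separates
    their values by [2 ^- (n + M).+1], while [t] and [t'] share at least [s * n - C] digits. *)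
Lemma fill_holder F b M s C : 0 <= s ->
  (forall n, exists i, (0 < i <= M)%N && F (n + i)%N) ->
  (forall n, s * n%:R - C <= (free_count F n)%:R) ->
  exists2 K, 0 < K & forall t t', 0 < t <= 1 -> 0 < t' <= 1 ->
    `|t - t'| <= K * `|dyadic_val (fill F b (bdigit t)) -
                       dyadic_val (fill F b (bdigit t'))| `^ s.
Proof.
move=> s0 hM hC; exists (2 `^ (C + s * M.+1%:R)) => [|t t' t01 t01'].
  by rewrite powR_gt0.
have C0 : 0 <= C.
  by have := hC 0%N; rewrite /free_count big_geq// mulr0 sub0r oppr_le0.
set e := fill F b (bdigit t); set e' := fill F b (bdigit t').
have two k : 2 ^- k = 2 `^ (- k%:R) :> R by rewrite powR_invn.
have [[n en]|no] := pselect (exists n, e n != e' n).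
  have [{en} n en nmin] := ex_minnP (ex_intro (fun n => e n != e' n) n en).
  have eq_e k : (k < n)%N -> e k = e' k.
    by move=> kn; apply/eqP; apply: contraTT kn; rewrite -leqNgt => /nmin.
  have [i /andP[iM Fi]] := hM n.
  have ei : e (n + i)%N = e' (n + i)%N by rewrite /e /e' /fill Fi.
  have h1 := dyadic_val_sep (R := R) eq_e en iM ei.
  have h2 := bdigit_close t01 t01' (fill_inj eq_e).
  apply: (le_trans h2); rewrite two.
  apply: (@le_trans _ _ (2 `^ (C + s * M.+1%:R) * (2 ^- (n + M).+1) `^ s)).
    rewrite two -powRrM -powRD; last by rewrite pnatr_eq0 implybT.
    rewrite ler_powR ?ler1n//.
    have := hC n; rewrite -addnS natrD; lra.
  rewrite ler_wpM2l ?powR_ge0//.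
  by rewrite ge0_ler_powR// nnegrE// invr_ge0 exprn_ge0.
have eq_e k : e k = e' k.
  by apply/eqP; apply: contra_notT no => h; exists k.
have h n := bdigit_close t01 t01' (fill_inj (fun k (_ : (k < n)%N) => eq_e k)).
(* For [s = 0] the free positions may be finitely many, so [t] and [t'] can differ; the bound then
   rests on 0 to the power 0 being 1. *)
have [s_eq0|s_neq0] := eqVneq s 0.
  apply: le_trans (h 0%N) _; rewrite /free_count big_geq// invr1.
  rewrite s_eq0 powRr0 mul0r addr0 mulr1.
  by rewrite -{1}(powRr0 2) ler_powR// ler1n.
suff -> : `|t - t'| = 0 by rewrite mulr_ge0// powR_ge0.
apply/eqP; apply/negPn/negP => d_neq0.
have d0 : 0 < `|t - t'| by rewrite lt_def d_neq0 normr_ge0.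
(* Far enough out, the number of shared free digits exceeds the inverse of the distance, a
   contradiction. *)
pose n := Num.truncn ((C + `|t - t'|^-1) / s).
have hn : (C + `|t - t'|^-1) / s < n.+1%:R by apply: truncnS_gt.
have s_gt0 : 0 < s by rewrite lt_def s_neq0.
rewrite ltr_pdivrMr// in hn.
have := h n.+1; apply/negP; rewrite -ltNge.
rewrite invf_plt ?posrE ?exprn_gt0//.
apply: (@lt_trans _ _ (free_count F n.+1)%:R).
  by have := hC n.+1; lra.
by rewrite -natrX ltr_nat ltn_expl.
Qed.

Lemma hausdorff_measure_fill F b M s C (A : set R) : 0 <= s ->
  (forall n, exists i, (0 < i <= M)%N && F (n + i)%N) ->
  (forall n, s * n%:R - C <= (free_count F n)%:R) ->
  (forall u, A (dyadic_val (fill F b u))) -> (0 < hausdorff_measure s A)%E.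
Proof.
move=> s0 hM hC hA.
have [K K0 hK] := @fill_holder F b M s C s0 hM hC.
apply: (hausdorff_measure_gt0 s0 K0 _ hK) => t _; exact: hA.
Qed.

End Prescribed.

(** * Digit sequences with sparse blocks and their Birkhoff sums *)

Section Blocks.
Context {R : realType}.
Variables N m : nat -> nat.
Hypothesis N_fit : forall k, (N k + m k < N k.+1)%N.

Lemma block_start_lt k l : (k < l)%N -> (N k + m k < N l)%N.
Proof.
elim: l => // l IH; rewrite ltnS leq_eqVlt => /orP[/eqP ->//|/IH h].
by have := N_fit l; lia.
Qed.

Lemma block_start_ge k : (k <= N k)%N.
Proof. by elim: k => // k IH; have := N_fit k; lia. Qed.

(** The bound [k <= j] makes the predicate boolean and loses nothing, since [k <= N k]. *)
Definition in_block j := [exists k : 'I_j.+1, (N k <= j <= N k + m k)%N].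

Lemma in_blockP j : reflect (exists k, N k <= j <= N k + m k)%N (in_block j).
Proof.
apply: (iffP existsP) => [[k kj]|[k kj]]; first by exists k.
have kj' : (k < j.+1)%N by have := block_start_ge k; lia.
by exists (Ordinal kj').
Qed.

(* The one at [N k] keeps the digits before the block from lengthening its run
   of zeros. *)
Definition block_digit j :=
  ~~ [exists k : 'I_j.+1, (N k < j < N k + m k)%N].

Lemma block_digitP j :
  reflect (exists k, N k < j < N k + m k)%N (~~ block_digit j).
Proof.
rewrite negbK; apply: (iffP existsP) => [[k kj]|[k kj]]; first by exists k.
have kj' : (k < j.+1)%N by have := block_start_ge k; lia.
by exists (Ordinal kj').
Qed.

Lemma block_inj k l j : (N k <= j <= N k + m k)%N ->
  (N l <= j <= N l + m l)%N -> k = l.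
Proof.
move=> hk hl; have [kl|lk|//] := ltngtP k l.
  by have := block_start_lt kl; lia.
by have := block_start_lt lk; lia.
Qed.

(** The start [N k] is excluded: it carries a one and is not part of the run that follows. *)
Definition block_interior j := exists k, (N k < j <= N k + m k)%N.

Lemma block_interior_window k j : (N k <= j < N k.+1)%N ->
  block_interior j -> (N k < j <= N k + m k)%N.
Proof.
move=> hj [l hl]; suff <- : l = k by [].
have [lk|kl|//] := ltngtP l k.
  by have := block_start_lt lk; lia.
have : (N k.+1 <= N l)%N.
  move: kl; rewrite leq_eqVlt => /orP[/eqP ->//|/block_start_lt]; lia.
lia.
Qed.

Variable M : nat.
Hypothesis M_gt0 : (0 < M)%N.

Definition block_forced j := in_block j || (M %| j)%N.

Variable u : nat -> bool.
Let e := fill block_forced block_digit u.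

Lemma fill_block k i : (i <= m k)%N -> e (N k + i) = (i == 0)%N || (i == m k).
Proof.
move=> im; have hk : (N k <= N k + i <= N k + m k)%N by lia.
have kin : in_block (N k + i) by apply/in_blockP; exists k.
rewrite /e /fill /block_forced kin /=.
apply/idP/idP => [|h].
  apply: contraTT => h; apply/block_digitP; exists k; lia.
apply: contraTT isT => /block_digitP[l hl].
have lk : l = k by apply: (@block_inj _ _ (N k + i)%N) => //; lia.
by move: hl h; rewrite lk; lia.
Qed.

(** The next multiple of [M] carries a one unless it falls in a block; then that block starts at or
    after [j], with a one. *)
Lemma fill_next_one j : ~ block_interior j -> exists2 i, (i < M)%N & e (j + i).
Proof.
move=> nj; pose i := ((M - j %% M) %% M)%N.
have iM : (i < M)%N by rewrite ltn_mod.
have Mji : (M %| j + i)%N.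
  rewrite /dvdn /i modnDmr -modnDml subnKC ?modnn// ltnW// ltn_mod//.
have [/in_blockP[k hk]|nin] := boolP (in_block (j + i)).
  have jk : (j <= N k)%N.
    by rewrite leqNgt; apply/negP => jk; apply: nj; exists k; lia.
  exists (N k - j)%N; first lia.
  by rewrite subnKC// -(addn0 (N k)) fill_block.
exists i => //; rewrite /e /fill /block_forced Mji orbT.
apply: contraNT nin => /block_digitP[k hk]; apply/in_blockP; exists k; lia.
Qed.

Lemma fill_infinitely_one : infinitely_one e.
Proof.
move=> n; exists (N n); first exact: block_start_ge.
by rewrite -(addn0 (N n)) fill_block.
Qed.

Let x : R := dyadic_val e.

Lemma saint_petersburg_fill_le j : ~ block_interior j ->
  saint_petersburg (iter j doubling x) <= 2 ^+ M.
Proof.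
move=> /fill_next_one[i iM ei].
have [r er rmin] := ex_minnP (ex_intro (fun r => e (j + r)) i ei).
rewrite iter_doubling_dyadic_val; last exact: fill_infinitely_one.
rewrite (@saint_petersburg_dyadic_val _ _ r)//.
- by rewrite ler_weXn2l ?ler1n// (leq_trans (rmin _ ei))// ltnW.
- exact/infinitely_one_shift/fill_infinitely_one.
- by move=> l lr; apply: contraTN lr => /rmin; rewrite leqNgt.
Qed.

Lemma saint_petersburg_fill_block k i : (i < m k)%N ->
  saint_petersburg (iter (N k + i.+1) doubling x) = 2 ^+ (m k - i.+1).
Proof.
move=> im; rewrite iter_doubling_dyadic_val; last exact: fill_infinitely_one.
apply: saint_petersburg_dyadic_val.
- exact/infinitely_one_shift/fill_infinitely_one.
- by rewrite -addnA subnKC// fill_block// eqxx orbT.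
- by move=> l lr; rewrite -addnA fill_block; lia.
Qed.

Lemma birkhoff_sum_cat a b (y : R) : (a <= b)%N -> birkhoff_sum b y =
  birkhoff_sum a y + \sum_(a <= j < b) saint_petersburg (iter j doubling y).
Proof. by move=> ab; rewrite /birkhoff_sum (big_cat_nat (leq0n a) ab). Qed.

(** The run counts down through the powers of two, a geometric sum. *)
Lemma sum_fill_block k : \sum_((N k).+1 <= j < (N k + m k).+1)
  saint_petersburg (iter j doubling x) = (2 ^ m k - 1)%:R.
Proof.
rewrite -(add0n (N k).+1) big_addn subSS addKn.
rewrite big_nat (eq_bigr (fun i => 2 ^+ (m k - i.+1))); last first.
  by move=> i /andP[_ im]; rewrite addnC addSnnS saint_petersburg_fill_block.
rewrite -big_nat big_nat_rev /= add0n.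
rewrite big_nat (eq_bigr (fun i => 2 ^+ i)); last first.
  by move=> i /andP[_ im]; congr (_ ^+ _); lia.
rewrite -big_nat; elim: (m k) => [|l IH]; first by rewrite big_geq.
rewrite big_nat_recr//= IH natrB ?expn_gt0// natrB ?expn_gt0//.
by rewrite !natrX exprS; lra.
Qed.

Definition block_sum k : nat := \sum_(0 <= i < k) (2 ^ m i - 1).

Lemma block_sumS k : block_sum k.+1 = (block_sum k + (2 ^ m k - 1))%N.
Proof. by rewrite /block_sum big_nat_recr. Qed.

Lemma sum_gap a b : (a <= b)%N -> (forall j, (a <= j < b)%N -> ~ block_interior j) ->
  0 <= \sum_(a <= j < b) saint_petersburg (iter j doubling x) <=
    2 ^+ M * (b - a)%:R.
Proof.
move=> ab h; apply/andP; split.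
  by apply: sumr_ge0 => j _; apply: le_trans (saint_petersburg_ge1 _).
rewrite mulrC mulr_natl -sumr_const_nat !big_nat; apply: ler_sum => j /h.
exact: saint_petersburg_fill_le.
Qed.

Lemma birkhoff_sum_block k :
  (block_sum k)%:R <= birkhoff_sum (N k) x <=
    (block_sum k)%:R + 2 ^+ M * (N k)%:R.
Proof.
have P0 : 0 < 2 ^+ M :> R by rewrite exprn_gt0.
elim: k => [|k IH].
  rewrite /block_sum big_geq// add0r.
  rewrite (@birkhoff_sum_cat 0)// {1 2}/birkhoff_sum big_geq// add0r.
  have := @sum_gap 0 (N 0) (leq0n _); rewrite subn0; apply.
  move=> j hj [l hl]; have := @block_start_lt 0 l; case: l hl => [|l] hl; lia.
have fit := N_fit k; have l1 : (N k <= (N k).+1)%N by [].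
have l2 : ((N k).+1 <= (N k + m k).+1)%N by lia.
(* Split the window into the start of the block, its interior, summed exactly, and the gap before
   the next block. *)
rewrite (birkhoff_sum_cat _ fit) (birkhoff_sum_cat _ l2) (birkhoff_sum_cat _ l1).
rewrite sum_fill_block block_sumS natrD.
have /andP[h1 h2] : 0 <= \sum_(N k <= j < (N k).+1)
    saint_petersburg (iter j doubling x) <= 2 ^+ M * ((N k).+1 - N k)%:R.
  apply: sum_gap => // j hj /(@block_interior_window k); lia.
have /andP[h3 h4] : 0 <= \sum_((N k + m k).+1 <= j < N k.+1)
    saint_petersburg (iter j doubling x) <=
    2 ^+ M * (N k.+1 - (N k + m k).+1)%:R.
  apply: sum_gap => // j hj /(@block_interior_window k); lia.
have -> : (N k.+1)%:R = (N k)%:R + ((N k).+1 - N k)%:R + (m k)%:R +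
    (N k.+1 - (N k + m k).+1)%:R :> R by rewrite -!natrD; congr (_%:R); lia.
have h5 : 0 <= 2 ^+ M * (m k)%:R :> R by rewrite mulr_ge0// ltW.
by rewrite !mulrDr; apply/andP; split; lra.
Qed.

End Blocks.

(** * Density of the free positions, and dimension one *)

Section BlocksDimension.
Context {R : realType}.
Variables (N m : nat -> nat).
Hypothesis N_fit : forall k, (N k + m k < N k.+1)%N.

Lemma sum_interval n a l :
  (\sum_(0 <= j < n) (a <= j <= a + l) = minn (n - a) l.+1)%N.
Proof.
elim: n => [|n IH]; first by rewrite big_geq.
by rewrite big_nat_recr//= IH; case: (boolP (_ <= _ <= _)%N) => /=; lia.
Qed.

Lemma sum_in_block n k : (n <= N k.+1)%N ->
  (\sum_(0 <= j < n) in_block N m j <= \sum_(0 <= i < k.+1) (m i).+1)%N.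
Proof.
move=> nN.
apply: (@leq_trans (\sum_(0 <= j < n) \sum_(0 <= i < k.+1) (N i <= j <= N i + m i))%N).
  rewrite big_nat [leqRHS](big_nat _ _ 0 n); apply: leq_sum => j /andP[_ jn].
  case: (boolP (in_block N m j)) => // /(in_blockP N_fit)[i hi].
  have ik : (i < k.+1)%N.
    by rewrite ltnNge; apply/negP; rewrite leq_eqVlt => /orP[/eqP|/(block_start_lt N_fit)];
      [move=> ki; rewrite ki in nN|]; lia.
  by rewrite (big_cat_nat (leq0n i) (ltnW ik)) /= [X in (_ <= _ + X)%N]big_ltn// hi; lia.
rewrite exchange_big_nat /=; apply: leq_sum => i _.
by rewrite sum_interval geq_minr.
Qed.

Lemma sum_dvdn M n : (0 < M)%N -> (\sum_(0 <= j < n.+1) (M %| j) = (n %/ M).+1)%N.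
Proof.
move=> M0; elim: n => [|n IH]; first by rewrite big_nat1 dvdn0 div0n.
by rewrite big_nat_recr//= IH divnS// addSn addnC.
Qed.

Lemma free_count_block M n k : (0 < M)%N -> (n <= N k.+1)%N ->
  (n <= free_count (block_forced N m M) n + (n %/ M).+1 +
        \sum_(0 <= i < k.+1) (m i).+1)%N.
Proof.
move=> M0 /sum_in_block; set B := (X in (_ <= X)%N) => hB.
suff : (n <= free_count (block_forced N m M) n + \sum_(0 <= j < n) (M %| j)%N +
   \sum_(0 <= j < n) in_block N m j)%N.
  have : (\sum_(0 <= j < n) (M %| j)%N <= (n %/ M).+1)%N.
    by rewrite -sum_dvdn// big_nat_recr//= leq_addr.
  lia.
elim: n {hB} => // n IH.
rewrite free_countS !big_nat_recr//= [block_forced _ _ _ n]/block_forced.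
case: (in_block N m n); case: (M %| n)%N => /=; lia.
Qed.

(* The blocks, hence the positions they force, have density zero. *)
Hypothesis m_small : forall eps : R, 0 < eps ->
  exists k0, forall k, (k0 <= k)%N ->
    (m k.+1).+1%:R <= eps * (N k.+1 - N k)%:R.

(** Late blocks are compared with the telescoping gaps [N k.+1 - N k]; the early ones go into
    [C]. *)
Lemma sum_block_length eps : 0 < eps -> exists2 C : R, 0 <= C & forall k,
  (\sum_(0 <= i < k.+1) (m i).+1)%:R <= C + eps * (N k - N 0)%:R.
Proof.
move=> eps0; have [k0 hk0] := m_small eps0.
exists (\sum_(0 <= i < k0.+1) (m i).+1)%:R => // k.
elim: k => [|k IH].
  rewrite subnn mulr0 addr0 ler_nat big_nat1.
  by rewrite big_nat_recl// leq_addr.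
have [kk0|kk0] := leqP k0 k.
  rewrite big_nat_recr//= natrD.
  have -> : (N k.+1 - N 0)%:R = (N k - N 0)%:R + (N k.+1 - N k)%:R :> R.
    rewrite -natrD; congr (_%:R); have := N_fit k.
    by case: k {IH kk0} => [|k]; [|have := block_start_lt N_fit (ltn0Sn k)]; lia.
  by have := hk0 k kk0; lra.
apply: ler_wpDr; first by rewrite mulr_ge0// ltW.
rewrite ler_nat.
by rewrite [leqRHS](big_cat_nat (leq0n k.+2)) ?leq_addr//=; lia.
Qed.

Lemma free_count_density s : 0 <= s < 1 ->
  exists2 M, (0 < M)%N & exists C : R, forall n,
    s * n%:R - C <= (free_count (block_forced N m M) n)%:R.
Proof.
(* Half of the density [1 - s] is spent on the multiples of [M], half on the blocks. *)
move=> /andP[s0 s1]; pose eps := (1 - s) / 2.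
have eps0 : 0 < eps by rewrite /eps; lra.
have [C C0 hC] := sum_block_length eps0.
pose M := (Num.truncn eps^-1).+1.
have hM : eps^-1 < M%:R by apply: truncnS_gt.
exists M => //; exists (C + 1) => n.
(* For the least such [k], either [k = 0] or [N k < n]; so the blocks cost at most [C + eps * n]. *)
have [k nk kmin] : exists2 k, (n <= N k.+1)%N &
    forall l, (n <= N l.+1)%N -> (k <= l)%N.
  have ex : exists k, (n <= N k.+1)%N.
    by exists n; have := block_start_ge N_fit n.+1; lia.
  by have [k hk hmin] := ex_minnP ex; exists k.
have h1 := @free_count_block M n k (ltn0Sn _) nk.
have {}hC : (\sum_(0 <= i < k.+1) (m i).+1)%:R <= C + eps * n%:R.
  apply: le_trans (hC k) _; rewrite lerD2l ler_pM2l// ler_nat.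
  case: k nk kmin {h1} => [|k] nk kmin; first by rewrite subnn.
  have : ~~ (n <= N k.+1)%N by apply/negP => /kmin; rewrite ltnn.
  lia.
have h2 : (n %/ M)%:R <= eps * n%:R.
  have : (n %/ M)%:R * M%:R <= n%:R :> R by rewrite -natrM ler_nat leq_divM.
  have d0 : 0 <= (n %/ M)%:R :> R by [].
  have : (n %/ M)%:R * eps^-1 <= (n %/ M)%:R * M%:R by rewrite ler_wpM2l// ltW.
  move=> a b; have := le_trans a b; rewrite ler_pdivrMr// mulrC //.
move: h1; rewrite -(ler_nat R) !natrD -(natr1 (n %/ M)).
have -> : s * n%:R = n%:R - eps * n%:R - eps * n%:R by rewrite /eps; lra.
lra.
Qed.

(** [A] has to accept every [M], because [M] grows as the exponent [s] approaches 1. *)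
Lemma hausdorff_dim_blocks (A : set R) : A `<=` [set x | 0 < x <= 1] ->
  (forall (x : R) M, 0 < x <= 1 ->
    (forall k, (block_sum m k)%:R <= birkhoff_sum (N k) x <=
       (block_sum m k)%:R + 2 ^+ M * (N k)%:R) -> A x) ->
  hausdorff_dim A = 1%E.
Proof.
move=> A01 hA; apply/eqP; rewrite eq_le hausdorff_dim_le1//=.
apply: hausdorff_dim_ge => // s s01; have [M M0 [C hC]] := free_count_density s01.
have /andP[s0 _] := s01.
apply: (@hausdorff_measure_fill _ _ (block_digit N m) M s C _ s0 _ hC) => [n|u].
  exists (M - n %% M)%N; apply/andP; split.
    by have := ltn_pmod n M0; lia.
  apply/orP; right; rewrite /dvdn -modnDml subnKC ?modnn//.
  by apply/ltnW/ltn_pmod.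
have inf1 := fill_infinitely_one N_fit M0 u.
apply: (hA _ M) => [|k]; last exact: birkhoff_sum_block.
by rewrite dyadic_val_gt0//; have /andP[] := dyadic_val_itv (R := R)
  (fill (block_forced N m M) (block_digit N m) u).
Qed.

End BlocksDimension.

(** * Level sets of finite level *)

Section GreedyBlocks.
Context {R : realType}.
Variable t : nat -> nat.
Hypothesis t_mono : {homo t : k l / (k <= l)%N}.
Hypothesis t_ratio : forall eta : R, 0 < eta ->
  \forall k \near \oo, (t k.+1)%:R <= (1 + eta) * (t k)%:R.
Hypothesis t_large : forall C : R, \forall k \near \oo, C <= (t k)%:R.

(* The bound [k] makes the block fit between [k ^ 2] and [k.+1 ^ 2]. *)
Definition greedy_step k G := minn k (trunc_log 2 (t k - G).+1).

(** The recursion is on the sum, on which the length of the next block depends. *)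
Fixpoint greedy_sum k :=
  if k is l.+1 then
    (greedy_sum l + (2 ^ greedy_step l (greedy_sum l) - 1))%N
  else 0%N.

Definition greedy_length k := greedy_step k (greedy_sum k).

Lemma block_sum_greedy k : block_sum greedy_length k = greedy_sum k.
Proof.
elim: k => [|k IH]; first by rewrite /block_sum big_geq.
by rewrite block_sumS IH.
Qed.

(** A block adds one less than a power of two that is at most the deficit plus one. The second bound
    controls the sum up to the next square. *)
Lemma greedy_sum_le k : (greedy_sum k <= t k)%N /\ (greedy_sum k.+1 <= t k)%N.
Proof.
have step l : (greedy_sum l <= t l)%N -> (greedy_sum l.+1 <= t l)%N.
  move=> h /=; have : (2 ^ greedy_step l (greedy_sum l) <=
      (t l - greedy_sum l).+1)%N.
    apply: leq_trans (_ : 2 ^ trunc_log 2 (t l - greedy_sum l).+1 <= _)%N.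
      by rewrite leq_exp2l// geq_minr.
    exact: trunc_logP.
  lia.
suff h : (greedy_sum k <= t k)%N by split => //; exact: step.
by elim: k => // k /step h; apply: leq_trans h (t_mono (leqnSn k)).
Qed.

(** Ratios tending to 1 make [t] grow slower than any exponential. *)
Lemma trunc_log_small (eps : R) : 0 < eps -> \forall k \near \oo,
  (trunc_log 2 (t k).+1).+1%:R <= eps * k%:R.
Proof.
move=> eps0; have ln2 : 0 < ln 2 :> R by rewrite ln_gt0// ltr1n.
(* The base-2 logarithm of [expR (eta * k)] is [eps * k / 2]; the other half absorbs the
   constants. *)
pose eta := eps * ln 2 / 2.
have eta0 : 0 < eta by rewrite /eta divr_gt0// mulr_gt0.
have [k0 _ hk0] := t_ratio eta0.
pose C : R := (t k0).+1%:R.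
have C0 : 0 < C by [].
have expR_ge1 (y : R) : 0 <= y -> 1 <= expR y by rewrite -expR0 ler_expR.
have bound k : (k0 <= k)%N -> (t k).+1%:R <= C * expR (eta * k%:R).
  elim: k => [|k IH].
    rewrite leqn0 => /eqP <-; apply: ler_peMr; first exact: ltW.
    by apply/expR_ge1/mulr_ge0 => //; exact: ltW.
  rewrite leq_eqVlt => /orP[/eqP <-|].
    apply: ler_peMr; first exact: ltW.
    by apply/expR_ge1/mulr_ge0 => //; exact: ltW.
  rewrite ltnS => kk; have := IH kk; have := hk0 k kk.
  rewrite -(natr1 (t k.+1)) -(natr1 (t k)) -(natr1 k) mulrDr mulr1 expRD => h1 h2.
  have h3 : 1 + eta <= expR eta by apply: expR_ge1Dx.
  have h4 : 0 <= (t k)%:R :> R by [].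
  apply: (@le_trans _ _ ((1 + eta) * ((t k)%:R + 1))); first lra.
  rewrite mulrA [X in _ <= X]mulrC; apply: ler_pM => //; lra.
pose A := ln C / ln 2 + 1.
near=> k.
have kk0 : (k0 <= k)%N by near: k; exists k0.
have kA : A * (2 / eps) <= k%:R by near: k; exact: nbhs_infty_ger.
set L := trunc_log 2 _.
have : 2 ^+ L <= C * expR (eta * k%:R).
  apply: le_trans (bound k kk0); rewrite -natrX ler_nat; exact: trunc_logP.
rewrite -ler_ln ?posrE ?exprn_gt0 ?mulr_gt0 ?expR_gt0//.
rewrite lnXn// lnM ?posrE ?expR_gt0// expRK -[_ *+ L]mulr_natl => h.
have : L%:R <= ln C / ln 2 + eps / 2 * k%:R.
  rewrite -(ler_pM2r ln2) mulrDl divfK ?gt_eqF//.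
  by apply: (le_trans h); rewrite /eta; lra.
rewrite -(natr1 L); move: kA; rewrite mulrA ler_pdivrMr// /A; lra.
Unshelve. all: by end_near. Qed.

(** Once the cap [k] in [greedy_step] is inactive, each block fills at least half of the deficit, up
    to the increment of [t]. *)
Lemma greedy_sum_ge (eta : R) : 0 < eta ->
  \forall k \near \oo, (1 - eta) * (t k)%:R <= (greedy_sum k)%:R.
Proof.
move=> eta0.
have [k1 _ hk1] : \forall k \near \oo,
    (trunc_log 2 (t k).+1 <= k)%N /\
    (t k.+1)%:R <= (1 + eta / 4) * (t k)%:R :> R.
  near=> k; split; last by near: k; apply: t_ratio; rewrite divr_gt0.
  suff : (trunc_log 2 (t k).+1).+1%:R <= 1 * k%:R :> R.
    by rewrite mul1r ler_nat => /ltnW.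
  by near: k; apply: trunc_log_small.
have step k : (k1 <= k)%N ->
    (t k.+1)%:R - (greedy_sum k.+1)%:R <=
    (t k.+1)%:R - (t k)%:R + ((t k)%:R - (greedy_sum k)%:R) / 2 :> R.
  move=> /hk1[kL _]; have [Gt _] := greedy_sum_le k.
  suff : (2 * t k <= 2 * greedy_sum k.+1 + (t k - greedy_sum k))%N.
    by rewrite -(ler_nat R) natrD !natrM (natrB _ Gt); lra.
  rewrite /= /greedy_step (minn_idPr _); last first.
    by apply: leq_trans kL; apply: leq_trunc_log; rewrite ltnS leq_subr.
  have := @trunc_log_ltn 2 (t k - greedy_sum k).+1 isT.
  rewrite expnS; lia.
pose d : R := (t k1)%:R - (greedy_sum k1)%:R.
have d0 : 0 <= d by rewrite subr_ge0 ler_nat; have [] := greedy_sum_le k1.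
(* The coefficient [eta / 2] is the fixed point of [c = eta / 4 + c / 2]: increment of [t] plus half
   of the old deficit. *)
have bound k : (k1 <= k)%N ->
    (t k)%:R - (greedy_sum k)%:R <= eta / 2 * (t k)%:R + d.
  have base : (t k1)%:R - (greedy_sum k1)%:R <= eta / 2 * (t k1)%:R + d.
    by rewrite lerDr mulr_ge0// divr_ge0// ltW.
  elim: k => [|k IH]; first (rewrite leqn0 => /eqP k10; move: base; rewrite k10; exact).
  rewrite leq_eqVlt => /orP[/eqP <-//|]; rewrite ltnS => kk.
  have := IH kk; have := step k kk; have [_] := hk1 k kk.
  have : eta * (t k)%:R <= eta * (t k.+1)%:R.
    by rewrite ler_wpM2l ?(ltW eta0)// ler_nat t_mono.
  lra.
near=> k.
have kk : (k1 <= k)%N by near: k; exists k1.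
have : d * (2 / eta) <= (t k)%:R by near: k; exact: t_large.
by rewrite mulrA ler_pdivrMr//; have := bound k kk; lra.
Unshelve. all: by end_near. Qed.

Lemma square_fit k : (k ^ 2 + greedy_length k < k.+1 ^ 2)%N.
Proof.
have : (greedy_length k <= k)%N by apply: geq_minl.
by rewrite !expnS; lia.
Qed.

Lemma greedy_length_small (eps : R) : 0 < eps -> exists k0, forall k,
  (k0 <= k)%N -> (greedy_length k.+1).+1%:R <= eps * (k.+1 ^ 2 - k ^ 2)%:R.
Proof.
move=> eps0; have [k0 _ hk0] := trunc_log_small eps0.
exists k0 => k kk; apply: (@le_trans _ _ (eps * k.+1%:R)).
  apply: le_trans (hk0 k.+1 (leqW kk)); rewrite ler_nat ltnS.
  apply: leq_trans (geq_minr _ _) _; apply: leq_trunc_log.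
  by rewrite ltnS leq_subr.
rewrite ler_pM2l// ler_nat; lia.
Qed.

End GreedyBlocks.

Lemma square_bracket n : exists k, (k ^ 2 <= n < k.+1 ^ 2)%N.
Proof.
elim: n => [|n [k /andP[h1 h2]]]; first by exists 0%N.
have [h|h] := ltnP n.+1 (k.+1 ^ 2); first by exists k; lia.
exists k.+1; rewrite h /=; move: h h2; rewrite !expnS; lia.
Qed.

Lemma square_succ_le k n : (0 < k)%N -> (k ^ 2 <= n)%N -> (k.+1 ^ 2 <= 4 * n)%N.
Proof.
move=> k0 kn; apply: (@leq_trans ((2 * k) ^ 2)); first by rewrite leq_sqr; lia.
by rewrite expnMn leq_mul2l kn.
Qed.

Lemma square_bracket_near (P : nat -> Prop) :
  (\forall k \near \oo, P k) ->
  \forall n \near \oo, exists2 k, (k ^ 2 <= n < k.+1 ^ 2)%N & P k.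
Proof.
move=> [k0 _ hk0]; exists (k0 ^ 2)%N => // n /= kn.
have [k hk] := square_bracket n; exists k => //; apply: hk0 => /=.
by have : (k0 ^ 2 < k.+1 ^ 2)%N by [lia|]; rewrite ltn_sqr.
Qed.

(** * Level 0 and the positive finite levels *)

Section LevelSets.
Context {R : realType}.
Implicit Types (Psi : nat -> R) (r : R).

Lemma level_set_sub Psi beta : level_set Psi beta `<=` [set x | 0 < x <= 1].
Proof. by move=> x []. Qed.

Lemma level_set_fin Psi r x : level_set Psi r%:E x <->
  0 < x <= 1 /\ birkhoff_sum n x / Psi n @[n --> \oo] --> r.
Proof.
split=> -[x01 h]; split => //; first by move/fine_cvgP: h => [].
by apply/fine_cvgP; split => //; apply: nearW.
Qed.

Lemma level_set_pinfty Psi x : level_set Psi +oo%E x <->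
  0 < x <= 1 /\ birkhoff_sum n x / Psi n @[n --> \oo] --> +oo.
Proof. by split=> -[x01 /cvgeryP h]. Qed.

Definition superlinear Psi := forall C, \forall n \near \oo, C * n%:R <= Psi n.

(** Blocks of length 0 are single forced ones and contribute nothing to [block_sum], so the Birkhoff
    sums grow at most linearly. *)
Lemma hausdorff_dim_level0 Psi : superlinear Psi ->
  hausdorff_dim (level_set Psi 0%E) = 1%E.
Proof.
move=> sup; apply: (@hausdorff_dim_blocks _ (fun k => k ^ 2)%N (fun=> 0%N)).
- by move=> k; rewrite addn0 ltn_sqr.
- move=> eps eps0.
  have [k0 _ hk0] := nbhs_infty_ger (eps^-1 : R).
  exists k0 => k kk; rewrite mulrC -ler_pdivrMr// mul1r.
  by apply: le_trans (hk0 k kk) _; rewrite ler_nat; lia.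
- exact: level_set_sub.
move=> x M x01 hS; apply/level_set_fin; split => //.
apply/cvgrPdist_le => e e0.
have near1 : \forall k \near \oo, (0 < k)%N by exists 1%N.
near=> n.
have [k /andP[kn nk] k0] : exists2 k, (k ^ 2 <= n < k.+1 ^ 2)%N & (0 < k)%N.
  by near: n; exact: square_bracket_near.
have Psi1 : 1 * n%:R <= Psi n by near: n; exact: sup.
have Psi2 : 2 ^+ M * 4 / e * n%:R <= Psi n by near: n; exact: sup.
have n0 : 0 < n%:R :> R by rewrite ltr0n; apply: leq_trans kn; rewrite sqrn_gt0.
have Psi0 : 0 < Psi n by apply: lt_le_trans Psi1; rewrite mul1r.
have S0 : 0 <= birkhoff_sum n x by apply: le_trans (birkhoff_sum_ge n x).
rewrite sub0r normrN ger0_norm; last by apply: divr_ge0 => //; exact: ltW.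
rewrite ler_pdivrMr//.
apply: le_trans (birkhoff_sum_mono x (ltnW nk)) _.
have /andP[_] := hS k.+1; rewrite /block_sum big1 ?add0r => [/le_trans|//].
apply; apply: (@le_trans _ _ (2 ^+ M * (4 * n%:R))).
  by rewrite ler_wpM2l ?exprn_ge0// -natrM ler_nat square_succ_le.
by move: Psi2; rewrite mulrAC ler_pdivrMr//; lra.
Unshelve. all: by end_near. Qed.

(** The greedy blocks follow the integer target [t k] at the squares; between squares the sums are
    monotone and [Psi] hardly changes. *)
Lemma hausdorff_dim_level_gt0 Psi r : 0 < r -> {homo Psi : m n / (m <= n)%N >-> m <= n} ->
  superlinear Psi ->
  (forall eta, 0 < eta ->
    \forall k \near \oo, Psi (k.+1 ^ 2)%N <= (1 + eta) * Psi (k ^ 2)%N) ->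
  hausdorff_dim (level_set Psi r%:E) = 1%E.
Proof.
move=> r0 mono sup ratio.
pose t k := Num.truncn (r * Psi (k ^ 2)%N).
have near_sq (P : nat -> Prop) : (\forall n \near \oo, P n) ->
    \forall k \near \oo, P (k ^ 2)%N.
  move=> [n0 _ hn0]; exists n0 => // k /= kn; apply: hn0 => /=.
  by apply: leq_trans kn _; rewrite -mulnn; case: k => // k; rewrite leq_pmull.
have t_mono : {homo t : k l / (k <= l)%N}.
  move=> k l kl; apply: le_truncn; rewrite ler_pM2l//; apply: mono.
  by rewrite leq_sqr.
have t_gt k : r * Psi (k ^ 2)%N < (t k)%:R + 1 by rewrite natr1 truncnS_gt.
have Psi_ge0 : \forall k \near \oo, 0 <= Psi (k ^ 2)%N.
  apply: (near_sq (fun j => 0 <= Psi j)); near=> n; apply: le_trans (_ : 1 * n%:R <= _).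
    by rewrite mul1r.
  by near: n; exact: sup.
have t_le : \forall k \near \oo, (t k)%:R <= r * Psi (k ^ 2)%N.
  near=> k; have P0 : 0 <= Psi (k ^ 2)%N by near: k.
  by have /truncn_itv/andP[] : 0 <= r * Psi (k ^ 2)%N by rewrite mulr_ge0// ltW.
have t_large (C : R) : \forall k \near \oo, C <= (t k)%:R.
  near=> k; suff : C + 1 <= r * Psi (k ^ 2)%N by have := t_gt k; lra.
  rewrite mulrC -ler_pdivrMr//.
  apply: (@le_trans _ _ (1 * (k ^ 2)%:R)).
    rewrite mul1r; near: k; apply: (near_sq (fun j => (C + 1) / r <= j%:R)).
    exact: nbhs_infty_ger.
  by near: k; apply: (near_sq (fun j => 1 * j%:R <= Psi j)); exact: sup.
have t_ratio (eta : R) : 0 < eta ->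
    \forall k \near \oo, (t k.+1)%:R <= (1 + eta) * (t k)%:R.
  move=> eta0; near=> k.
  have h1 : (t k.+1)%:R <= r * Psi (k.+1 ^ 2)%N.
    near: k; have [k0 _ hk0] := t_le; exists k0 => // k /= kk.
    by apply: hk0; exact: leqW.
  have h2 : Psi (k.+1 ^ 2)%N <= (1 + eta / 2) * Psi (k ^ 2)%N.
    by near: k; apply: ratio; rewrite divr_gt0.
  have h3 : (1 + eta / 2) * (2 / eta) <= (t k)%:R by near: k; exact: t_large.
  have h4 : (1 + eta / 2) * (r * Psi (k ^ 2)%N) <= (1 + eta / 2) * ((t k)%:R + 1).
    by rewrite ler_pM2l ?ltW//; lra.
  have h5 : r * Psi (k.+1 ^ 2)%N <= r * ((1 + eta / 2) * Psi (k ^ 2)%N).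
    by rewrite ler_pM2l.
  rewrite mulrA ler_pdivrMr// in h3; lra.
apply: (@hausdorff_dim_blocks _ (fun k => k ^ 2)%N (greedy_length t)).
- exact: square_fit.
- exact: greedy_length_small.
- exact: level_set_sub.
move=> x M x01 hS; apply/level_set_fin; split => //.
apply/cvgrPdist_le => e e0.
(* The lower bound loses two factors [1 - eta], which cost at most [e / 2]; the truncation in [t]
   takes the other half. *)
pose eta := Num.min (e / (4 * r)) (1 / 2).
have eta0 : 0 < eta by rewrite /eta lt_min !divr_gt0// mulr_gt0.
have eta1 : eta <= 1 / 2 by rewrite /eta ge_min lexx orbT.
have eta2 : eta * r <= e / 4.
  have : eta <= e / (4 * r) by rewrite /eta ge_min lexx.
  by rewrite -(ler_pM2r r0) invfM mulrA divfK ?gt_eqF.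
have nearP : \forall k \near \oo, [/\ (0 < k)%N, (t k)%:R <= r * Psi (k ^ 2)%N,
    (1 - eta) * (t k)%:R <= (greedy_sum t k)%:R &
    Psi (k.+1 ^ 2)%N <= (1 + eta) * Psi (k ^ 2)%N].
  near=> k; split; near: k.
  - by exists 1%N.
  - exact: t_le.
  - exact: greedy_sum_ge.
  - exact: ratio.
near=> n.
have [k /andP[kn nk] [k0 tk Gk rk]] : exists2 k, (k ^ 2 <= n < k.+1 ^ 2)%N &
    [/\ (0 < k)%N, (t k)%:R <= r * Psi (k ^ 2)%N,
    (1 - eta) * (t k)%:R <= (greedy_sum t k)%:R &
    Psi (k.+1 ^ 2)%N <= (1 + eta) * Psi (k ^ 2)%N].
  by near: n; exact: square_bracket_near.
have Psi1 : 1 * n%:R <= Psi n by near: n; exact: sup.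
have Psi2 : 2 ^+ M * 4 / e * n%:R <= Psi n by near: n; exact: sup.
have n1 : 2 / e <= n%:R by near: n; exact: nbhs_infty_ger.
have n0 : 0 < n%:R :> R by rewrite ltr0n; apply: leq_trans kn; rewrite sqrn_gt0.
have Psi0 : 0 < Psi n by apply: lt_le_trans Psi1; rewrite mul1r.
have /andP[low _] := hS k; have /andP[_ up] := hS k.+1.
rewrite !block_sum_greedy in low up.
have {up} up : birkhoff_sum n x <= r * Psi n + e * Psi n.
  apply: le_trans (birkhoff_sum_mono x (ltnW nk)) _.
  apply: (le_trans up); apply: lerD.
    (* The sum before the next square is bounded by the target at [k], not at [k.+1], and
       [Psi (k ^ 2) <= Psi n]. *)
    have [_ h] := greedy_sum_le t_mono k.
    apply: (@le_trans _ _ (t k)%:R); first by rewrite ler_nat.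
    by apply: (le_trans tk); rewrite ler_pM2l// mono.
  apply: (@le_trans _ _ (2 ^+ M * (4 * n%:R))).
    by rewrite ler_wpM2l ?exprn_ge0// -natrM ler_nat square_succ_le.
  by move: Psi2; rewrite mulrAC ler_pdivrMr//; lra.
have {low} low : r * Psi n - e * Psi n <= birkhoff_sum n x.
  apply: le_trans (birkhoff_sum_mono x kn).
  apply: le_trans low; apply: le_trans Gk.
  have h1 : Psi n <= (1 + eta) * Psi (k ^ 2)%N.
    by apply: le_trans rk; apply: mono; exact: ltnW.
  have h2 := t_gt k.
  have h3 : (1 - eta) * Psi n <= Psi (k ^ 2)%N.
    apply: (@le_trans _ _ ((1 - eta) * ((1 + eta) * Psi (k ^ 2)%N))).
      by rewrite ler_pM2l//; lra.
    rewrite mulrA ler_piMl//; last first.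
      by have := mulr_ge0 (ltW eta0) (ltW eta0); lra.
    by rewrite -(pmulr_rge0 _ (_ : 0 < 1 + eta)) ?(le_trans (ltW Psi0))//; lra.
  have h4 : r * ((1 - eta) * Psi n) - 1 <= (t k)%:R.
    have : r * ((1 - eta) * Psi n) <= r * Psi (k ^ 2)%N by rewrite ler_pM2l.
    lra.
  have h5 : (1 - eta) * (r * ((1 - eta) * Psi n) - 1) <= (1 - eta) * (t k)%:R.
    by rewrite ler_pM2l//; lra.
  have h6 : 2 <= e * Psi n.
    by rewrite mulrC -ler_pdivrMr//; apply: le_trans n1 _; rewrite mul1r in Psi1.
  apply: le_trans h5.
  have h7 : eta * r * Psi n <= e / 4 * Psi n by rewrite ler_pM2r.
  have h8 : 0 <= eta * (eta * r * Psi n).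
    by apply: mulr_ge0; [|apply: mulr_ge0; [apply: mulr_ge0|]]; exact: ltW.
  lra.
by rewrite distrC ler_norml; apply/andP; split;
  [rewrite lerBrDr ler_pdivlMr|rewrite lerBlDr ler_pdivrMr]; lra.
Unshelve. all: by end_near. Qed.

End LevelSets.

(** * The growth rates, and the level +oo *)

Section Growth.
Context {R : realType}.
Implicit Types (a c gamma eps : R) (n k : nat).

Definition exp_pow gamma n : R := 2 `^ (n%:R `^ gamma).

Lemma exp_pow_gt0 gamma n : 0 < exp_pow gamma n.
Proof. exact: powR_gt0. Qed.

Lemma ler_exp2 : {homo (fun y : R => 2 `^ y) : y z / y <= z}.
Proof. by move=> y z yz; apply: ler_powR => //; rewrite ler1n. Qed.

Lemma powR_nat_large c A : 0 < c -> \forall n \near \oo, A <= n%:R `^ c :> R.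
Proof.
move=> c0; near=> n.
have hn : `|A| `^ c^-1 <= n%:R by near: n; exact: nbhs_infty_ger.
apply: le_trans (ler_norm A) _.
have -> : `|A| = (`|A| `^ c^-1) `^ c.
  by rewrite -powRrM mulVf ?powRr1// gt_eqF.
by apply: ge0_ler_powR => //; rewrite ?nnegrE ?powR_ge0// ltW.
Unshelve. all: by end_near. Qed.

Lemma ln_le_powR c (y : R) : 0 < c -> 0 < y -> ln y <= y `^ c / c.
Proof.
move=> c0 y0; rewrite ler_pdivlMr// mulrC -ln_powR.
by apply/ltW/ln_sublinear/powR_gt0.
Qed.

(** After taking logarithms, one factor [n ^ (gamma / 2)] of [n ^ gamma] dominates [ln n] and the
    other one the constants. *)
Lemma powR_le_exp_pow a gamma : 0 <= a -> 0 < gamma ->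
  \forall n \near \oo, n%:R `^ a <= exp_pow gamma n.
Proof.
move=> a0 g0; have ln2 : 0 < ln 2 :> R by rewrite ln_gt0// ltr1n.
have g2 : 0 < gamma / 2 by rewrite divr_gt0.
near=> n.
have n0 : 0 < n%:R :> R by near: n; exact: nbhs_infty_gtr.
have hz : a / (gamma / 2) / ln 2 <= n%:R `^ (gamma / 2).
  by near: n; exact: powR_nat_large.
rewrite -ler_ln ?posrE ?exp_pow_gt0 ?powR_gt0// !ln_powR.
have -> : n%:R `^ gamma = n%:R `^ (gamma / 2) * n%:R `^ (gamma / 2) :> R.
  by rewrite -powRD -?splitr//; apply/implyP => _; rewrite gt_eqF.
have := ln_le_powR g2 n0.
move: hz; set z := n%:R `^ (gamma / 2) => hz hl.
have z0 : 0 <= z by apply: powR_ge0.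
apply: (@le_trans _ _ (a * (z / (gamma / 2)))); first by rewrite ler_wpM2l.
have -> : a * (z / (gamma / 2)) = z * (a / (gamma / 2)).
  by rewrite mulrA mulrAC [in LHS]mulrC.
by rewrite -mulrA ler_wpM2l// -ler_pdivrMr.
Unshelve. all: by end_near. Qed.

Lemma exp_pow_superlinear gamma : 0 < gamma -> superlinear (exp_pow gamma).
Proof.
move=> g0 C; near=> n.
have Cn : C <= n%:R by near: n; exact: nbhs_infty_ger.
apply: (@le_trans _ _ (n%:R `^ 2%:R)).
  by rewrite powR_mulrn// expr2 ler_wpM2r.
by near: n; apply: powR_le_exp_pow.
Unshelve. all: by end_near. Qed.

Lemma powR_superlinear a : 1 < a -> superlinear (fun n => n%:R `^ a).
Proof.
move=> a1 C; near=> n.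
have hn : C <= n%:R `^ (a - 1).
  by near: n; apply: powR_nat_large; rewrite subr_gt0.
by rewrite -mulr_powRB1//; [rewrite mulrC ler_wpM2l|lra].
Unshelve. all: by end_near. Qed.

Lemma nln_superlinear : superlinear (fun n => n%:R * ln n%:R : R).
Proof.
move=> C; near=> n.
have n0 : 0 < n%:R :> R by near: n; exact: nbhs_infty_gtr.
have hn : expR C <= n%:R by near: n; exact: nbhs_infty_ger.
rewrite mulrC ler_wpM2l//.
by rewrite -[leLHS]expRK ler_ln ?posrE// expR_gt0.
Unshelve. all: by end_near. Qed.

Lemma exp_pow_mono gamma : 0 <= gamma ->
  {homo exp_pow gamma : m n / (m <= n)%N >-> m <= n}.
Proof.
move=> g0 m n mn; apply: ler_exp2; apply: ge0_ler_powR => //; rewrite ?nnegrE//.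
by rewrite ler_nat.
Qed.

Lemma powR_mono a : 0 <= a ->
  {homo (fun n => n%:R `^ a : R) : m n / (m <= n)%N >-> m <= n}.
Proof.
move=> a0 m n mn; apply: ge0_ler_powR => //; rewrite ?nnegrE//.
by rewrite ler_nat.
Qed.

Lemma nln_mono :
  {homo (fun n => n%:R * ln n%:R : R) : m n / (m <= n)%N >-> m <= n}.
Proof.
move=> [|m] [|n] // mn.
  by rewrite mul0r mulr_ge0// ln_ge0// ler1n.
by apply: ler_pM => //; rewrite ?ln_ge0 ?ler1n ?ler_ln ?posrE ?ler_nat.
Qed.

(** Factor out [n ^ c] and use [(1 + 1 / n) ^ c <= 1 + 1 / n]. *)
Lemma powRS_le c n : (0 < n)%N -> 0 <= c <= 1 ->
  n.+1%:R `^ c <= n%:R `^ c + n%:R `^ (c - 1) :> R.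
Proof.
move=> n0 /andP[c0 c1].
have nR : 0 < n%:R :> R by rewrite ltr0n.
have nV : 0 <= n%:R^-1 :> R by rewrite invr_ge0.
have -> : n.+1%:R = n%:R * (1 + n%:R^-1) :> R.
  by rewrite mulrDr mulr1 mulfV ?gt_eqF// natr1.
rewrite powRM ?addr_ge0//.
rewrite powRB ?powRr1//; last by apply/implyP => _; rewrite gt_eqF.
rewrite -[X in _ <= X + _]mulr1 -mulrDr ler_wpM2l ?powR_ge0//.
by apply: ler1_powR => //; lra.
Qed.

(** The exponent increases by at most [n ^ (c - 1)], which tends to 0. *)
Lemma exp_pow_ratio c eps : 0 <= c < 1 -> 0 < eps ->
  \forall n \near \oo, exp_pow c n.+1 <= (1 + eps) * exp_pow c n.
Proof.
move=> /andP[c0 c1] eps0.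
have l0 : 0 < ln (1 + eps) by rewrite ln_gt0// ltrDl.
have ln2 : 0 < ln 2 :> R by rewrite ln_gt0// ltr1n.
near=> n.
have n0 : (0 < n)%N by near: n; exists 1%N.
have hn : ln 2 / ln (1 + eps) <= n%:R `^ (1 - c).
  by near: n; apply: powR_nat_large; rewrite subr_gt0.
apply: (@le_trans _ _ (2 `^ (n%:R `^ c + n%:R `^ (c - 1)))).
  by apply: ler_exp2; apply: powRS_le => //; rewrite c0 ltW.
rewrite (@powRD _ 2); last by apply/implyP => _; rewrite pnatr_eq0.
rewrite mulrC; apply: ler_wpM2r; first exact: powR_ge0.
rewrite -ler_ln ?posrE ?powR_gt0//; last lra.
rewrite ln_powR -opprB powRN mulrC ler_pdivrMr ?powR_gt0 ?ltr0n//.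
by rewrite mulrC -ler_pdivrMr.
Unshelve. all: by end_near. Qed.

Lemma square_powR (y : R) c : 0 <= y -> (y ^+ 2) `^ c = y `^ (2 * c).
Proof. by move=> y0; rewrite -powR_mulrn// -powRrM. Qed.

(** Along squares the exponent becomes [2 * gamma], and [gamma < 1 / 2] keeps it below 1. *)
Lemma exp_pow_square_ratio gamma eps : 0 < gamma < 1 / 2 -> 0 < eps ->
  \forall k \near \oo,
    exp_pow gamma (k.+1 ^ 2) <= (1 + eps) * exp_pow gamma (k ^ 2).
Proof.
move=> g01 eps0; have sq k : exp_pow gamma (k ^ 2) = exp_pow (2 * gamma) k.
  by rewrite /exp_pow natrX square_powR.
near=> k; rewrite !sq; near: k; apply: exp_pow_ratio => //.
by apply/andP; split; lra.
Unshelve. all: by end_near. Qed.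

Lemma lnS_le n : (0 < n)%N -> ln n.+1%:R <= ln n%:R + n%:R^-1 :> R.
Proof.
move=> n0; have nR : 0 < n%:R :> R by rewrite ltr0n.
have nV : 0 < n%:R^-1 :> R by rewrite invr_gt0.
have -> : n.+1%:R = n%:R * (1 + n%:R^-1) :> R.
  by rewrite mulrDr mulr1 mulfV ?gt_eqF// natr1.
by rewrite lnM ?posrE ?addr_gt0// lerD2l le_ln1Dx//; lra.
Qed.

Lemma powR_square_ratio a eps : 0 <= a -> 0 < eps ->
  \forall k \near \oo,
    (k.+1 ^ 2)%:R `^ a <= (1 + eps) * (k ^ 2)%:R `^ a :> R.
Proof.
move=> a0 eps0.
have l0 : 0 < ln (1 + eps) by rewrite ln_gt0// ltrDl.
near=> k.
have k0 : (0 < k)%N by near: k; exists 1%N.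
have kR : 0 < k%:R :> R by rewrite ltr0n.
have hk : 2 * a / ln (1 + eps) <= k%:R by near: k; exact: nbhs_infty_ger.
rewrite !natrX !square_powR//.
rewrite -ler_ln ?posrE ?mulr_gt0 ?powR_gt0//; try lra.
rewrite lnM ?posrE ?powR_gt0//; last lra.
rewrite !ln_powR.
have : 2 * a * ln k.+1%:R <= 2 * a * (ln k%:R + k%:R^-1).
  by rewrite ler_wpM2l ?lnS_le// mulr_ge0.
have : 2 * a * k%:R^-1 <= ln (1 + eps).
  by rewrite ler_pdivrMr// [leRHS]mulrC -ler_pdivrMr.
lra.
Unshelve. all: by end_near. Qed.

Lemma nln_square_ratio eps : 0 < eps -> \forall k \near \oo,
  (k.+1 ^ 2)%:R * ln (k.+1 ^ 2)%:R <=
    (1 + eps) * ((k ^ 2)%:R * ln (k ^ 2)%:R) :> R.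
Proof.
move=> eps0; near=> k.
have k0 : (0 < k)%N by near: k; exists 1%N.
have kR : 0 < k%:R :> R by rewrite ltr0n.
have k1 : 1 <= k%:R :> R by rewrite ler1n.
(* The constant comes from [(1 + v) ^ 3 <= 1 + 7 * v] for [v] in [0, 1]. *)
have hk : 7 / eps <= k%:R by near: k; exact: nbhs_infty_ger.
have lk : expR 1 <= k%:R :> R by near: k; exact: nbhs_infty_ger.
have {}lk : 1 <= ln k%:R :> R.
  by rewrite -[leLHS]expRK ler_ln ?posrE// expR_gt0.
rewrite !natrX !lnXn// -[ln _ *+ 2]mulr_natl -[ln k%:R *+ 2]mulr_natl.
have := lnS_le k0; have := ln_ge0 (_ : 1 <= k.+1%:R :> R); rewrite ler1n => /(_ isT).
have -> : k.+1%:R = k%:R * (1 + k%:R^-1) :> R.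
  by rewrite mulrDr mulr1 mulfV ?gt_eqF// natr1.
have v0 : 0 < k%:R^-1 :> R by rewrite invr_gt0.
have hv : 7 * k%:R^-1 <= eps.
  by rewrite ler_pdivrMr// mulrC -ler_pdivrMr.
have v1 : k%:R^-1 <= 1 :> R by rewrite invf_le1.
set l := ln (_ * _); set v := k%:R^-1 in v0 v1 hv *; set L := ln k%:R in lk *.
move=> l0 hl.
have h1 : l <= L * (1 + v) by nra.
have h2 : (1 + v) ^+ 3 <= 1 + eps.
  have : v ^+ 2 <= v by rewrite expr2; nra.
  have : v ^+ 3 <= v by rewrite exprS expr2; nra.
  by rewrite !exprS expr0; nra.
have -> : (k%:R * (1 + v)) ^+ 2 * (2 * l) = 2 * k%:R ^+ 2 * ((1 + v) ^+ 2 * l).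
  by ring.
have -> : (1 + eps) * (k%:R ^+ 2 * (2 * L)) = 2 * k%:R ^+ 2 * ((1 + eps) * L).
  by ring.
rewrite ler_wpM2l ?mulr_ge0 ?exprn_ge0//.
apply: (@le_trans _ _ ((1 + v) ^+ 2 * (L * (1 + v)))).
  by rewrite ler_wpM2l// exprn_ge0//; lra.
have -> : (1 + v) ^+ 2 * (L * (1 + v)) = (1 + v) ^+ 3 * L by ring.
by rewrite ler_wpM2r//; lra.
Unshelve. all: by end_near. Qed.

End Growth.

(** * The level +oo for exponents below 1 *)

Section InfiniteLevel.
Context {R : realType}.
Variable gamma : R.
Hypothesis g01 : 0 < gamma < 1.
Let g0 : 0 < gamma. Proof. by have /andP[] := g01. Qed.
Let g1 : gamma < 1. Proof. by have /andP[] := g01. Qed.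

(* Long enough for [2 ^ pow_length k] to exceed [exp_pow gamma n ^ 2] up to
   [n = 2 ^ k.+2], by which the next block has ended. *)
Definition pow_length k : nat :=
  (Num.truncn (2 * (2 ^ k.+2)%:R `^ gamma)).+1.

(** The cap makes every block end before the next power of two; it is eventually inactive. *)
Definition infinite_length k := minn (pow_length k) (2 ^ k - 1).

Lemma infinite_fit k : (2 ^ k + infinite_length k < 2 ^ k.+1)%N.
Proof.
have : (infinite_length k <= 2 ^ k - 1)%N by apply: geq_minr.
have : (0 < 2 ^ k)%N by rewrite expn_gt0.
rewrite expnS; lia.
Qed.

Lemma pow_length_small eps : 0 < eps -> \forall k \near \oo,
  (pow_length k.+1).+1%:R <= eps * (2 ^ k)%:R :> R.
Proof.
move=> eps0; near=> k.
(* 18 = 2 * 8 + 2: the factor 8 comes from [2 ^ k.+3], and the final 2 from the two successors. *)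
have hk : 18 / eps <= k%:R `^ (1 - gamma).
  by near: k; apply: powR_nat_large; rewrite subr_gt0.
set y : R := (2 ^ k)%:R.
have y1 : 1 <= y by rewrite ler1n expn_gt0.
have hy : 18 / eps <= y `^ (1 - gamma).
  apply: (le_trans hk); apply: ge0_ler_powR; rewrite ?nnegrE//.
  - by rewrite subr_ge0 ltW.
  - by rewrite ler_nat ltnW// ltn_expl.
have yg1 : 1 <= y `^ gamma.
  by rewrite -[leLHS](powRr0 y) ler_powR// ltW.
have yE : y = y `^ (1 - gamma) * y `^ gamma.
  by rewrite -powRD ?subrK ?powRr1//; apply/implyP => _; rewrite gt_eqF//; lra.
have h8 : (2 ^ k.+3)%:R `^ gamma <= 8 * y `^ gamma.
  rewrite (_ : (2 ^ k.+3)%:R = 8 * y); last by rewrite -natrM !expnS !mulnA.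
  rewrite powRM//.
  by rewrite ler_wpM2r ?powR_ge0// ler1_powR ?ler1n// ltW.
have : (pow_length k.+1)%:R <= 2 * (2 ^ k.+3)%:R `^ gamma + 1.
  rewrite /pow_length -(natr1 (Num.truncn _)) lerD2r.
  by have /truncn_itv/andP[] : 0 <= 2 * (2 ^ k.+3)%:R `^ gamma :> R
    by rewrite mulr_ge0// powR_ge0.
rewrite -(natr1 (pow_length _)).
suff : 18 * y `^ gamma <= eps * y by lra.
rewrite {2}yE mulrA ler_wpM2r ?powR_ge0//.
by rewrite mulrC -ler_pdivrMr.
Unshelve. all: by end_near. Qed.

Lemma infinite_length_near :
  \forall k \near \oo, infinite_length k.+1 = pow_length k.+1.
Proof.
near=> k; apply/minn_idPl.
have : (pow_length k.+1).+1%:R <= 1 * (2 ^ k)%:R :> R.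
  by near: k; exact: pow_length_small.
by rewrite mul1r ler_nat expnS; lia.
Unshelve. all: by end_near. Qed.

Lemma hausdorff_dim_level_infinite :
  hausdorff_dim (level_set (exp_pow gamma) +oo%E) = 1%E.
Proof.
apply: (@hausdorff_dim_blocks _ (expn 2) infinite_length).
- exact: infinite_fit.
- move=> eps eps0; have [k0 _ hk0] := pow_length_small eps0.
  exists k0 => k kk; rewrite expnS mul2n -addnn addnK.
  by apply: le_trans (hk0 k kk); rewrite ler_nat ltnS geq_minl.
- exact: level_set_sub.
move=> x M x01 hS; apply/level_set_pinfty; split => //.
apply/cvgryPge => A.
have [k0 _ hk0] := infinite_length_near.
near=> n.
have hA : `|A| + 1 <= exp_pow gamma n.
  near: n; near=> n; apply: (@le_trans _ _ (1 * n%:R)).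
    by rewrite mul1r; near: n; exact: nbhs_infty_ger.
  by near: n; apply: exp_pow_superlinear.
have kn : (2 ^ k0.+2 <= n)%N by near: n; exists (2 ^ k0.+2)%N.
have n0 : (0 < n)%N by apply: leq_trans kn; rewrite expn_gt0.
have /andP[h1 h2] := trunc_log_bounds (isT : (1 < 2)%N) n0.
have kk : (k0.+2 <= trunc_log 2 n)%N by apply: trunc_log_max.
case: (trunc_log 2 n) kk h1 h2 => // -[//|k] kk h1 h2.
(* Block [k.+1] has ended before [2 ^ k.+2 <= n], and [n < 2 ^ k.+3] is in the range for which its
   length was chosen. *)
have low : (2 ^ infinite_length k.+1 - 1)%:R <= birkhoff_sum n x.
  apply: le_trans (birkhoff_sum_mono x h1).
  have /andP[+ _] := hS k.+2; apply: le_trans.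
  by rewrite ler_nat block_sumS leq_addl.
have Psi0 := exp_pow_gt0 gamma n.
have hL : exp_pow gamma n * exp_pow gamma n <= (2 ^ infinite_length k.+1)%:R.
  rewrite hk0//= natrX -powR_mulrn// /exp_pow -powRD; last first.
    by apply/implyP => _; rewrite pnatr_eq0.
  apply: ler_exp2; apply: (@le_trans _ _ (2 * (2 ^ k.+3)%:R `^ gamma)).
    have : n%:R `^ gamma <= (2 ^ k.+3)%:R `^ gamma :> R.
      apply: ge0_ler_powR; rewrite ?nnegrE//; first exact: ltW.
      by rewrite ler_nat ltnW.
    lra.
  by apply/ltW/truncnS_gt.
rewrite ler_pdivlMr//; apply: le_trans low.
rewrite natrB ?expn_gt0//.
have : (`|A| + 1) * exp_pow gamma n <= exp_pow gamma n * exp_pow gamma n.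
  by rewrite ler_pM2r.
have : A * exp_pow gamma n <= `|A| * exp_pow gamma n.
  by rewrite ler_pM2r// ler_norm.
have := normr_ge0 A; move: hL.
by move: (2 ^ _)%:R => B; lra.
Unshelve. all: by end_near. Qed.

(** Lets a single fast rate settle the level +oo for all slower ones. *)
Lemma level_set_infinite_mono (Psi Psi' : nat -> R) :
  (\forall n \near \oo, 0 < Psi n <= Psi' n) ->
  level_set Psi' +oo%E `<=` level_set Psi +oo%E.
Proof.
move=> hPsi x /level_set_pinfty[x01 /cvgryPge h].
apply/level_set_pinfty; split => //; apply/cvgryPge => A; near=> n.
have /andP[P0 PP] : 0 < Psi n <= Psi' n by near: n.
apply: (@le_trans _ _ (birkhoff_sum n x / Psi' n)); first by near: n; exact: h.
rewrite ler_wpM2l ?(le_trans _ (birkhoff_sum_ge n x))//.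
by rewrite lef_pV2 ?posrE//; apply: lt_le_trans PP.
Unshelve. all: by end_near. Qed.

End InfiniteLevel.

(** * Empty level sets *)

Section Emptiness.
Context {R : realType}.
Implicit Types (x r eps gamma : R).

Local Notation phi n x := (saint_petersburg (iter n doubling x)).

Lemma saint_petersburg_pow2 x : exists m, saint_petersburg x = 2 ^+ m.
Proof. by eexists. Qed.

(** Along a run each term equals the drop of twice the current value. *)
Lemma birkhoff_sum_run x n m i : 0 < x <= 1 -> phi n x = 2 ^+ m ->
  (i <= m)%N ->
  birkhoff_sum (n + i) x + 2 * 2 ^+ (m - i) = birkhoff_sum n x + 2 * 2 ^+ m.
Proof.
move=> x01 nm; elim: i => [|i IH] im; first by rewrite addn0 subn0.
rewrite -IH ?(ltnW im)// addnS birkhoff_sumS addnC iterD.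
rewrite (saint_petersburg_run nm) ?iter_doubling_itv ?(ltnW im)// addnC.
have -> : 2 ^+ (m - i) = 2 * 2 ^+ (m - i.+1) :> R by rewrite -exprS -subSn.
lra.
Qed.

Lemma saint_petersburg_eq1_often x K : 0 < x <= 1 ->
  exists2 n, (K <= n)%N & phi n x = 1.
Proof.
move=> x01; have [m hm] := saint_petersburg_pow2 (iter K doubling x).
exists (m + K)%N; first exact: leq_addl.
by rewrite iterD (saint_petersburg_run hm) ?iter_doubling_itv// subnn.
Qed.

(** Going back in time a term at most doubles at each step, so the sum is dominated by a geometric
    one. *)
Lemma birkhoff_sum_le_pow2 x n : 0 < x <= 1 ->
  birkhoff_sum n.+1 x <= (2 ^+ n.+1 - 1) * phi n x.
Proof.
move=> x01; elim: n => [|n IH].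
  by rewrite birkhoff_sumS /birkhoff_sum big_geq// expr1; lra.
rewrite birkhoff_sumS.
have h1 := saint_petersburg_double (iter_doubling_itv n x01).
rewrite -iterS in h1.
have h2 : (2 ^+ n.+1 - 1) * phi n x <= (2 ^+ n.+1 - 1) * (2 * phi n.+1 x).
  by rewrite ler_wpM2l// subr_ge0 exprn_ege1// ler1n.
move: IH h2; rewrite [2 ^+ n.+2]exprS; lra.
Qed.

Lemma exp_pow_ge_pow2 gamma n : 1 <= gamma -> (0 < n)%N ->
  2 ^+ n <= exp_pow gamma n.
Proof.
move=> g1 n0; rewrite -powR_mulrn//; apply: ler_exp2.
by rewrite le1r_powR// ler1n.
Qed.

Lemma exp_powS_ge gamma n : 1 <= gamma -> (0 < n)%N ->
  2 * exp_pow gamma n <= exp_pow gamma n.+1.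
Proof.
move=> g1 n0; have n1 : 1 <= n%:R :> R by rewrite ler1n.
rewrite -{1}(powRr1 (_ : 0 <= 2))// /exp_pow -powRD; last first.
  by apply/implyP => _; rewrite pnatr_eq0.
apply: ler_exp2.
have g10 : 0 <= gamma - 1 by rewrite subr_ge0.
rewrite -(@mulr_powRB1 _ n%:R)//; last lra.
rewrite -(@mulr_powRB1 _ n.+1%:R)//; last lra.
have h1 : n%:R `^ (gamma - 1) <= n.+1%:R `^ (gamma - 1) :> R.
  by apply: ge0_ler_powR; rewrite ?nnegrE// ler_nat.
have h2 : 1 <= n%:R `^ (gamma - 1) :> R.
  by rewrite -[leLHS](powRr0 n%:R) ler_powR.
rewrite -natr1 in h1 *; nra.
Qed.

Lemma cvg_ratio_bounds (S Psi : nat -> R) r eps : 0 < eps ->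
  (\forall n \near \oo, 0 < Psi n) -> S n / Psi n @[n --> \oo] --> r ->
  \forall n \near \oo, (r - eps) * Psi n <= S n <= (r + eps) * Psi n.
Proof.
move=> eps0 P0 /cvgrPdist_le/(_ _ eps0) h; near=> n.
have Pn : 0 < Psi n by near: n.
have : `|r - S n / Psi n| <= eps by near: n.
by rewrite ler_distlC ler_pdivlMr// ler_pdivrMr.
Unshelve. all: by end_near. Qed.

Lemma level_set_exp_pow_high_pinfty gamma : 1 <= gamma ->
  level_set (@exp_pow R gamma) +oo%E = set0.
Proof.
move=> g1; rewrite -subset0 => x /level_set_pinfty[x01 /cvgryPge/(_ 2)[K _ hK]].
have [n Kn n1] := saint_petersburg_eq1_often K x01.
have := hK n.+1 (leqW Kn); rewrite ler_pdivlMr ?exp_pow_gt0//.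
have := @exp_pow_ge_pow2 gamma n.+1 g1 isT.
have := birkhoff_sum_le_pow2 n x01; rewrite n1 mulr1.
have : 0 < 2 ^+ n.+1 :> R by rewrite exprn_gt0.
lra.
Qed.

Lemma level_set_exp_pow_high_fin gamma r : 1 <= gamma -> 0 < r ->
  level_set (exp_pow gamma) r%:E = set0.
Proof.
move=> g1 r0; rewrite -subset0 => x /level_set_fin[x01 h].
(* At the end of a run, doubling [Psi] would require [14 / 8 * r * Psi n] to be at most
   [9 / 8 * r * Psi n + 1], where [1 < r / 8 * Psi n]. *)
have r8 : 0 < r / 8 by rewrite divr_gt0.
have [K _ hK] : \forall n \near \oo, [/\ (0 < n)%N, 8 / r < exp_pow gamma n &
    (r - r / 8) * exp_pow gamma n <= birkhoff_sum n x
      <= (r + r / 8) * exp_pow gamma n].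
  near=> n; split; near: n.
  - by exists 1%N.
  - near=> n; apply: (@lt_le_trans _ _ (1 * n%:R)).
      by rewrite mul1r; near: n; exact: nbhs_infty_gtr.
    by near: n; apply: exp_pow_superlinear; lra.
  - apply: cvg_ratio_bounds => //; near=> n; exact: exp_pow_gt0.
have [n Kn n1] := saint_petersburg_eq1_often K x01.
have [n0 hr /andP[_ up]] := hK n Kn; have [_ _ /andP[low _]] := hK n.+1 (leqW Kn).
move: low; rewrite birkhoff_sumS n1 => low.
have h2 := exp_powS_ge g1 n0.
have : (r - r / 8) * (2 * exp_pow gamma n) <= (r - r / 8) * exp_pow gamma n.+1.
  by rewrite ler_wpM2l// subr_ge0 ler_pdivrMr// ler_peMr ?ler1n// ltW.
move: hr low up; rewrite ltr_pdivrMr//.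
move: (exp_pow gamma n.+1) (exp_pow gamma n) (birkhoff_sum n x) r0.
by clear => *; lra.
Unshelve. all: by end_near. Qed.

(** The bound [1 / n.+1 ^ 2 <= 1 / n - 1 / n.+1] telescopes. Such small terms cannot add up to a
    fixed proportion of [Psi] when [K] is large. *)
Lemma birkhoff_sum_telescope (Psi : nat -> R) x K :
  {homo Psi : m n / (m <= n)%N >-> m <= n} -> (0 < K)%N -> 0 <= Psi 0%N ->
  (forall n, (K <= n)%N -> phi n x <= Psi n / n.+1%:R ^+ 2) ->
  forall n, (K <= n)%N ->
    birkhoff_sum n x <= birkhoff_sum K x + Psi n * (K%:R^-1 - n%:R^-1).
Proof.
move=> mono K0 Psi0 hphi; elim=> [|n IH]; first by rewrite leqn0; case: K K0 hphi.
rewrite leq_eqVlt => /orP[/eqP <-|]; first by rewrite subrr mulr0 addr0.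
rewrite ltnS => Kn; have n0 : (0 < n)%N by apply: leq_trans Kn.
have Pn : 0 <= Psi n by apply: le_trans Psi0 (mono _ _ (leq0n n)).
have h1 : n.+1%:R ^+ 2 >= n.+1%:R * n%:R :> R.
  by rewrite expr2 ler_wpM2l// ler_nat.
have nR : 0 < n%:R :> R by rewrite ltr0n.
have h2 : (n.+1%:R ^+ 2)^-1 <= n%:R^-1 - n.+1%:R^-1 :> R.
  have -> : n%:R^-1 - n.+1%:R^-1 = (n.+1%:R * n%:R)^-1 :> R.
    rewrite -(natr1 n); field.
    by rewrite natr1 !pnatr_eq0 /= -lt0n n0.
  by rewrite lef_pV2 ?posrE ?exprn_gt0 ?mulr_gt0.
have h3 : Psi n * (n.+1%:R ^+ 2)^-1 <= Psi n * (n%:R^-1 - n.+1%:R^-1).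
  by rewrite ler_wpM2l.
have h4 : Psi n * (K%:R^-1 - n.+1%:R^-1) <= Psi n.+1 * (K%:R^-1 - n.+1%:R^-1).
  rewrite ler_wpM2r ?mono// subr_ge0 lef_pV2 ?posrE ?ltr0n// ler_nat.
  exact: leqW.
rewrite birkhoff_sumS; have := hphi n Kn; have := IH Kn; move: h3 h4.
move: (_ ^-1) (n.+1%:R^-1) (n%:R^-1) (K%:R^-1) => c a b d; lra.
Qed.

(** Since [n ^ gamma >= sqrt n], adding [m] multiplies [sqrt n] by at least
    [q = 1 + 1 / (8 * sqrt n)]; then [n ^ gamma] also gains the factor [q], that is at least 1/8. *)
Lemma exp_pow_gap gamma n m : 1 / 2 <= gamma -> (0 < n)%N ->
  n%:R `^ gamma / 2 <= m%:R ->
  2 `^ (1 / 8) * exp_pow gamma n <= exp_pow gamma (n + m).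
Proof.
move=> g12 n0 hm; have n1 : 1 <= n%:R :> R by rewrite ler1n.
pose w : R := Num.sqrt n%:R.
have w1 : 1 <= w by rewrite -sqrtr1 ler_wsqrtr.
have wn : n%:R = w ^+ 2 by rewrite sqr_sqrtr.
have wg : w <= n%:R `^ gamma.
  by rewrite /w -powR12_sqrt// ler_powR//; lra.
rewrite /exp_pow -powRD; last by apply/implyP => _; rewrite pnatr_eq0.
apply: ler_exp2.
have v0 : 0 < w^-1 by rewrite invr_gt0; lra.
pose q := 1 + w^-1 / 8.
have q1 : 1 <= q by rewrite /q; lra.
have wq : w * q = w + 1 / 8.
  by rewrite /q mulrDr mulr1 mulrA mulfV//; apply/eqP; lra.
have h1 : (w * q) ^+ 2 <= (n + m)%:R by rewrite natrD wn wq expr2; nra.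
have h2 : n%:R `^ gamma * q <= (n + m)%:R `^ gamma.
  apply: (@le_trans _ _ (((w * q) ^+ 2) `^ gamma)).
    rewrite exprMn -wn powRM ?exprn_ge0//; try lra.
    rewrite ler_wpM2l ?powR_ge0//.
    by rewrite square_powR; [apply: le1r_powR => //|]; lra.
  by apply: ge0_ler_powR => //; rewrite ?nnegrE ?exprn_ge0//; nra.
apply: le_trans h2.
have h3 : 1 <= n%:R `^ gamma * w^-1.
  by rewrite ler_pdivlMr ?mul1r//; lra.
rewrite /q mulrDr mulr1 mulrA; lra.
Qed.

(** Turns a term above [Psi n / n.+1 ^ 2] into a run longer than [n ^ gamma / 2]. *)
Lemma exp_pow_half gamma : 0 < gamma -> \forall n \near \oo,
  n.+1%:R ^+ 2 * 2 `^ (n%:R `^ gamma / 2) <= exp_pow gamma n :> R.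
Proof.
move=> g0; near=> n.
have n4 : 4 <= n%:R :> R by near: n; exact: nbhs_infty_ger.
have hz : 2 <= n%:R `^ (gamma / 2) :> R.
  by near: n; apply: powR_nat_large; rewrite divr_gt0.
have h3 : n%:R `^ 3%:R <= exp_pow (gamma / 2) n :> R.
  by near: n; apply: powR_le_exp_pow => //; rewrite divr_gt0.
have -> : exp_pow gamma n = 2 `^ (n%:R `^ gamma / 2) * 2 `^ (n%:R `^ gamma / 2) :> R.
  rewrite -powRD -?splitr//; apply/implyP => _; rewrite pnatr_eq0//.
rewrite ler_wpM2r ?powR_ge0//.
apply: (@le_trans _ _ (exp_pow (gamma / 2) n)).
  apply: le_trans h3; rewrite powR_mulrn// -natr1 !exprS expr0; nra.
apply: ler_exp2.
have -> : n%:R `^ gamma = n%:R `^ (gamma / 2) * n%:R `^ (gamma / 2) :> R.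
  by rewrite -powRD -?splitr//; apply/implyP => _; rewrite gt_eqF//; lra.
nra.
Unshelve. all: by end_near. Qed.

Lemma level_set_exp_pow_mid gamma r : 1 / 2 <= gamma < 1 -> 0 < r ->
  level_set (exp_pow gamma) r%:E = set0.
Proof.
move=> /andP[g12 g1] r0; rewrite -subset0 => x /level_set_fin[x01 h].
have g0 : 0 < gamma by lra.
pose q : R := 2 `^ (1 / 8).
have q1 : 1 < q.
  have : 1 `^ (1 / 8) < q by apply: gt0_ltr_powR; rewrite ?nnegrE ?ltr1n//; lra.
  by rewrite powR1.
have q2 : q <= 2 by rewrite /q ler1_powR ?ler1n//; lra.
pose eps := Num.min (r * (q - 1) / 20) (1 / 2).
have eps0 : 0 < eps by rewrite /eps lt_min !divr_gt0// mulr_gt0// subr_gt0.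
have eps1 : eps <= 1 / 2 by rewrite /eps ge_min lexx orbT.
have epsr : eps <= r * (q - 1) / 20 by rewrite /eps ge_min lexx.
have eps_r : eps <= r.
  have : r * (q - 1) <= r * 1 by apply: (ler_wpM2l (ltW r0)); lra.
  lra.
(* 7 = 1 + 2 * 3: [eps] from the sum at [n], and twice a term of size at most [3 * eps * Psi n] from
   the run. *)
have key : r + 7 * eps < (r - eps) * q.
  have : eps * q <= eps * 2 by apply: (ler_wpM2l (ltW eps0)).
  have : 0 < r * (q - 1) by rewrite mulr_gt0// subr_gt0.
  lra.
have Psi0 : \forall n \near \oo, 0 < exp_pow gamma n.
  by near=> n; exact: exp_pow_gt0.
pose eta := Num.min (eps / (r + eps)) 1.
have eta0 : 0 < eta by rewrite /eta lt_min divr_gt0 ?addr_gt0// ltr01.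
have etar : eta * (r + eps) <= eps.
  by rewrite -ler_pdivlMr ?addr_gt0// /eta ge_min lexx.
have [K _ hK] : \forall n \near \oo, [/\ (0 < n)%N, 4 / r < n%:R,
    n.+1%:R ^+ 2 * 2 `^ (n%:R `^ gamma / 2) <= exp_pow gamma n :> R,
    exp_pow gamma n.+1 <= (1 + eta) * exp_pow gamma n &
    (r - eps) * exp_pow gamma n <= birkhoff_sum n x
      <= (r + eps) * exp_pow gamma n].
  near=> n; split; near: n.
  - by exists 1%N.
  - exact: nbhs_infty_gtr.
  - exact: exp_pow_half.
  - by apply: exp_pow_ratio => //; lra.
  - exact: cvg_ratio_bounds.
have [K0 Kr _ _ _] := hK K (leqnn K).
(* Without a large term, telescoping bounds some later sum by [r / 2 * Psi], against the lower bound
   [3 / 4 * r * Psi]. *)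
have [[n Kn hn]|no] := pselect (exists2 n, (K <= n)%N &
    exp_pow gamma n / n.+1%:R ^+ 2 < phi n x); last first.
  have hphi n : (K <= n)%N -> phi n x <= exp_pow gamma n / n.+1%:R ^+ 2.
    by move=> Kn; rewrite leNgt; apply/negP => hn; apply: no; exists n.
  have tel := birkhoff_sum_telescope (exp_pow_mono (ltW g0)) K0
    (ltW (exp_pow_gt0 _ _)) hphi.
  have [L _ hL] : \forall n \near \oo,
      birkhoff_sum K x * (4 / r) <= exp_pow gamma n /\
      (r - r / 4) * exp_pow gamma n <= birkhoff_sum n x
      <= (r + r / 4) * exp_pow gamma n.
    near=> n; split; near: n.
      near=> n; apply: (@le_trans _ _ (1 * n%:R)).
        by rewrite mul1r; near: n; exact: nbhs_infty_ger.
      by near: n; exact: exp_pow_superlinear.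
    by apply: cvg_ratio_bounds; rewrite ?divr_gt0.
  have [h1 /andP[h2 _]] := hL (maxn K L) (leq_maxr _ _).
  have := tel (maxn K L) (leq_maxl _ _).
  have P0 := exp_pow_gt0 gamma (maxn K L).
  have KV : K%:R^-1 <= r / 4.
    by rewrite invf_ple ?posrE ?ltr0n ?divr_gt0// invf_div ltW.
  have nV : 0 <= (maxn K L)%:R^-1 :> R by [].
  have : exp_pow gamma (maxn K L) * (K%:R^-1 - (maxn K L)%:R^-1) <=
    exp_pow gamma (maxn K L) * (r / 4).
    apply: (ler_wpM2l (ltW P0)); rewrite lerBlDr; apply: (le_trans KV).
    by rewrite lerDl.
  rewrite mulrA ler_pdivrMr// in h1.
  have : 0 < r * exp_pow gamma (maxn K L) by rewrite mulr_gt0.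
  lra.
have [n0 _ hhalf hratio /andP[lown upn]] := hK n Kn.
have [_ _ _ _ /andP[_ upn1]] := hK n.+1 (leqW Kn).
have P0 := exp_pow_gt0 gamma n.
(* The term is a difference of consecutive sums, both close to [r * Psi n] because
   [Psi n.+1 / Psi n] is close to 1. *)
have small : phi n x <= 3 * eps * exp_pow gamma n.
  move: upn1; rewrite birkhoff_sumS.
  have : (r + eps) * exp_pow gamma n.+1 <=
      (r + eps) * ((1 + eta) * exp_pow gamma n).
    by rewrite ler_wpM2l// ltW// addr_gt0.
  have : eta * (r + eps) * exp_pow gamma n <= eps * exp_pow gamma n.
    by apply: (ler_wpM2r (ltW P0)).
  move: lown; move: (exp_pow gamma n.+1) (exp_pow gamma n) (birkhoff_sum n x).
  by move: (phi n x); clear => *; lra.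
have [m hm] := saint_petersburg_pow2 (iter n doubling x).
have mg : n%:R `^ gamma / 2 <= m%:R.
  rewrite leNgt; apply/negP => mlt.
  have : 2 ^+ m <= 2 `^ (n%:R `^ gamma / 2) :> R.
    by rewrite -powR_mulrn//; apply: ler_exp2; exact: ltW.
  rewrite -hm; apply/negP; rewrite -ltNge; apply: le_lt_trans hn.
  by rewrite ler_pdivlMr ?exprn_gt0// mulrC.
have gap := exp_pow_gap g12 n0 mg.
have := birkhoff_sum_run x01 hm (leqnn m); rewrite subnn -hm => run.
have [_ _ _ _ /andP[lowm _]] := hK (n + m)%N (leq_trans Kn (leq_addr _ _)).
have : (r - eps) * (q * exp_pow gamma n) <= (r - eps) * exp_pow gamma (n + m).
  by rewrite ler_wpM2l// subr_ge0.
have : (r + 7 * eps) * exp_pow gamma n < (r - eps) * q * exp_pow gamma n.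
  by rewrite (ltr_pM2r P0).
move: run P0 small upn lowm; rewrite expr0.
move: (exp_pow gamma (n + m)) (exp_pow gamma n) (birkhoff_sum (n + m) x).
by move: (birkhoff_sum n x) (phi n x) eps0; clear => *; lra.
Unshelve. all: by end_near. Qed.

End Emptiness.

(** * Assembly of the three growth regimes *)

Theorem theorem1p2 (R : realType) :
  (forall Psi : nat -> R,
     [\/ Psi = (fun n : nat => n%:R * ln n%:R),
         exists2 a : R, 1 < a & Psi = (fun n : nat => n%:R `^ a) |
         exists2 gamma : R, 0 < gamma < 1 / 2 &
           Psi = (fun n : nat => 2 `^ (n%:R `^ gamma))] ->
     forall beta : \bar R, (0 <= beta)%E ->
       hausdorff_dim (level_set Psi beta) = 1%E)
  /\
  (forall gamma : R, 1 / 2 <= gamma < 1 ->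
     let Psi := fun n : nat => 2 `^ (n%:R `^ gamma) in
     [/\ forall beta : \bar R, (0 < beta < +oo)%E ->
           level_set Psi beta = set0,
         hausdorff_dim (level_set Psi 0%E) = 1%E &
         hausdorff_dim (level_set Psi +oo%E) = 1%E])
  /\
  (forall gamma : R, 1 <= gamma ->
     let Psi := fun n : nat => 2 `^ (n%:R `^ gamma) in
     (forall beta : \bar R, (0 < beta)%E -> level_set Psi beta = set0) /\
     hausdorff_dim (level_set Psi 0%E) = 1%E).
Proof.
have dim0 (gamma : R) : 0 < gamma ->
    hausdorff_dim (level_set (exp_pow gamma) 0%E) = 1%E.
  by move=> g0; apply: hausdorff_dim_level0; exact: exp_pow_superlinear.
split; last split.
- move=> Psi hPsi beta.
  have [sup mono ratio dom] : [/\ superlinear Psi,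
      {homo Psi : m n / (m <= n)%N >-> m <= n},
      forall eta, 0 < eta ->
        \forall k \near \oo, Psi (k.+1 ^ 2)%N <= (1 + eta) * Psi (k ^ 2)%N &
      \forall n \near \oo, Psi n <= exp_pow (1 / 2) n].
    case: hPsi => [->|[a a1 ->]|[gamma g12 ->]]; split.
    + exact: nln_superlinear.
    + exact: nln_mono.
    + by move=> eta; exact: nln_square_ratio.
    + near=> n.
      have n0 : 0 < n%:R :> R by near: n; exact: nbhs_infty_gtr.
      apply: (@le_trans _ _ (n%:R `^ 2%:R)).
        by rewrite powR_mulrn// expr2 ler_wpM2l// ltW// ln_sublinear.
      by near: n; apply: powR_le_exp_pow; lra.
    + exact: powR_superlinear.
    + by apply: powR_mono; lra.
    + by move=> eta; apply: powR_square_ratio; lra.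
    + by apply: powR_le_exp_pow; lra.
    + by apply: exp_pow_superlinear; lra.
    + by apply: exp_pow_mono; lra.
    + by move=> eta; exact: exp_pow_square_ratio.
    + near=> n; apply: ler_exp2; apply: ler_powR; last lra.
      by near: n; exact: nbhs_infty_ger.
  case: beta => [r| |//] r0.
    move: r0; rewrite lee_fin le_eqVlt => /orP[/eqP <-|r0].
      exact: hausdorff_dim_level0.
    exact: hausdorff_dim_level_gt0.
  apply/eqP; rewrite eq_le hausdorff_dim_le1/=; last exact: level_set_sub.
  (* All rates of the first regime are eventually at most [exp_pow (1 / 2)], whose level set at +oo
     already has dimension one. *)
  have half : (0 < 1 / 2 :> R) && (1 / 2 < 1 :> R) by apply/andP; split; lra.
  rewrite -(@hausdorff_dim_level_infinite R _ half).
  apply: hausdorff_dim_mono; apply: level_set_infinite_mono.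
  near=> n; apply/andP; split; last by near: n.
  apply: (@lt_le_trans _ _ (1 * n%:R)); last by near: n; exact: sup.
  by rewrite mul1r; near: n; exact: nbhs_infty_gtr.
- move=> gamma g12 Psi; split.
  + move=> [r| |]//; last by rewrite ltxx andbF.
    by rewrite lte_fin ltry andbT; exact: level_set_exp_pow_mid.
  + by apply: dim0; lra.
  + by apply: hausdorff_dim_level_infinite; lra.
- move=> gamma g1 Psi; split; last by apply: dim0; lra.
  move=> [r| |//] r0; last exact: level_set_exp_pow_high_pinfty.
  exact: level_set_exp_pow_high_fin.
Unshelve. all: by end_near. Qed.
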